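(* Let $E$ be a non-trivial elementary abelian $2$-group. Let $U$ and $V$ be finite-dimensional Euclidean $E$-modules such that $U\neq 0$, $\bigcap_{\alpha\in E^*:\,U^\alpha\neq 0}\ker\alpha=0$ and $V^E=0$. Consider the $E$-space $\mathrm{map}_*(S(\mathbb R\oplus U),\mathbb R)$ of continuous real-valued functions on the unit sphere $S(\mathbb R\oplus U)$ that are zero at the basepoint $(1,0)$. Suppose that $f:\mathrm{map}_*(S(\mathbb R\oplus U),\mathbb R)\to V$ is a continuous $E$-equivariant map. Then, for any $d\ge 0$, the zero-set of $f$ contains a compact $E$-invariant subspace on which $E$ acts freely and whose covering dimension is greater than or equal to $d$.
   Context: $E$ is viewed as an $\mathbb F_2$-vector space and $E^*=\mathrm{Hom}(E,\mathbb F_2)$. A Euclidean $E$-module is a real $E$-module with an $E$-invariant inner product. For $\alpha\in E^*$, $U^\alpha=\{u\in U\mid gu=(-1)^{\alpha(g)}u\text{ for all }g\in E\}$, and $V^E$ is the fixed subspace. $E$ acts trivially on the summand $\mathbb R$ of $\mathbb R\oplus U$, and acts on functions by $(g\cdot\varphi)(x)=\varphi(g^{-1}x)$. The mapping space has the compact-open topology (equivalently, that of the sup norm). Covering dimension is Lebesgue covering dimension. *)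

(* Defs.v *)
From HB Require Import structures.
From mathcomp Require Import all_boot all_order all_algebra sesquilinear.
From mathcomp Require Import all_classical all_reals all_analysis.
From mathcomp Require Import ring lra.

Set Implicit Arguments.
Unset Strict Implicit.
Unset Printing Implicit Defensive.

Import Order.TTheory GRing.Theory Num.Theory.
Import numFieldNormedType.Exports.

Local Open Scope classical_set_scope.
Local Open Scope card_scope.
Local Open Scope ring_scope.

(* An elementary abelian 2-group, of any cardinality, is the same thing as an
   F_2-vector space.  It is taken here as E : lmodType 'F_2 and written
   additively: the unit is 0, the inverse of g is - g, and the dual group is
   {scalar E}. *)

Record euclideanModule (R : realType) (E : lmodType 'F_2) := EuclideanModule {
  emod_vect : vectType R;
  emod_inner : {dot emod_vect for idfun};
  emod_act : E -> 'End(emod_vect);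
  emod_act0 : emod_act 0 = \1%VF;
  emod_actD : forall g h, emod_act (g + h) = (emod_act g \o emod_act h)%VF;
  emod_inner_act : forall g u v,
    emod_inner (emod_act g u) (emod_act g v) = emod_inner u v
}.

(* The carrier of U, with the norm and the topology of its inner product. *)
Definition emod_space (R : realType) (E : lmodType 'F_2)
  (U : euclideanModule R E) : Type := emod_vect U.

Coercion emod_space : euclideanModule >-> Sortclass.

Section EuclideanNorm.
Context {R : realType} {E : lmodType 'F_2} (U : euclideanModule R E).

HB.instance Definition _ := Vector.on (emod_space U).

Definition inner (u v : U) : R := emod_inner U u v.

Definition enorm (u : U) : R := Num.sqrt (inner u u).

Lemma innerC (u v : U) : inner u v = inner v u.
Proof. by rewrite /inner hermC expr0 mul1r. Qed.

Lemma innerDl (u v w : U) : inner (u + v) w = inner u w + inner v w.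
Proof. exact: linearDl. Qed.

Lemma innerZl (a : R) (u v : U) : inner (a *: u) v = a * inner u v.
Proof. exact: linearZl_LR. Qed.

Lemma inner_gt0 (u : U) : u != 0 -> 0 < inner u u.
Proof. exact: neq0_dnorm_gt0. Qed.

Lemma inner0l (u : U) : inner 0 u = 0.
Proof. exact: linear0l. Qed.

Lemma inner_ge0 (u : U) : 0 <= inner u u.
Proof.
have [->|/inner_gt0/ltW//] := eqVneq u 0.
by rewrite inner0l.
Qed.

Lemma innerDr (u v w : U) : inner w (u + v) = inner w u + inner w v.
Proof. by rewrite innerC innerDl !(innerC w). Qed.

Lemma innerZr (a : R) (u v : U) : inner v (a *: u) = a * inner v u.
Proof. by rewrite innerC innerZl innerC. Qed.

Lemma enorm_sqr (u : U) : enorm u ^+ 2 = inner u u.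
Proof. by rewrite sqr_sqrtr ?inner_ge0. Qed.

Lemma inner_cauchy_schwarz (u v : U) :
  inner u v ^+ 2 <= inner u u * inner v v.
Proof.
have [->|v0] := eqVneq v 0.
  by rewrite innerC !inner0l mulr0 expr0n.
have vv := inner_gt0 v0.
have := inner_ge0 (inner v v *: u + (- inner u v) *: v).
rewrite !(innerDl, innerDr, innerZl, innerZr) (innerC v u).
rewrite (_ : _ + _ = inner v v * (inner u u * inner v v - inner u v ^+ 2)).
  by rewrite pmulr_rge0// subr_ge0.
by ring.
Qed.

Lemma ler_enormD (u v : U) : enorm (u + v) <= enorm u + enorm v.
Proof.
have uv : inner u v <= enorm u * enorm v.
  rewrite (le_trans (ler_norm _))// -sqrtr_sqr /enorm -sqrtrM ?inner_ge0//.
  by rewrite ler_wsqrtr// inner_cauchy_schwarz.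
rewrite -(ler_pXn2r (_ : (0 < 2)%N)) ?nnegrE ?addr_ge0 ?sqrtr_ge0//.
rewrite sqrrD !enorm_sqr innerDl !innerDr (innerC v u); lra.
Qed.

Lemma enormZ (a : R) (u : U) : enorm (a *: u) = `|a| * enorm u.
Proof.
by rewrite /enorm innerZl innerZr mulrA -expr2 sqrtrM ?sqr_ge0// sqrtr_sqr.
Qed.

Lemma enorm0_eq0 (u : U) : enorm u = 0 -> u = 0.
Proof.
move=> u0; apply/eqP; apply: contraT => /inner_gt0.
by rewrite -enorm_sqr u0 expr0n ltxx.
Qed.

HB.instance Definition _ :=
  Lmodule_isNormed.Build R (emod_space U) ler_enormD enormZ enorm0_eq0.

Definition act (g : E) (u : U) : U := emod_act U g u.

Lemma actB (g : E) (u v : U) : act g (u - v) = act g u - act g v.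
Proof. exact: linearB. Qed.

Lemma norm_act (g : E) (u : U) : `|act g u| = `|u|.
Proof. by rewrite /Num.norm/= /enorm /inner emod_inner_act. Qed.

Lemma act_continuous (g : E) : continuous (act g).
Proof.
move=> u; apply: (@cvgrPdist_lt R U U (nbhs u) (nbhs_filter u) _ _).2.
move=> e e0; near=> v; rewrite -actB norm_act; near: v.
have := @cvgr_dist_lt R U U (nbhs u) (nbhs_filter u) id u.
by apply => //; exact: cvg_id.
Unshelve. all: by end_near. Qed.

(* U^alpha.  The value alpha g : 'F_2 coerces to 0 or 1 in nat. *)
Definition eigenset (alpha : {scalar E}) : set U :=
  [set u | forall g, act g u = (-1) ^+ (alpha g : 'F_2) *: u].

Definition fixed_points : set U := [set u | forall g, act g u = u].

(* The unit sphere S(R (+) U).  The norm of the library on R * U is the max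
   norm, hence the explicit equation; its topology is the product topology. *)
Definition sphere_set : set (R * U) :=
  [set x | x.1 ^+ 2 + `|x.2| ^+ 2 = 1].

Definition sphere : Type := set_type sphere_set.

HB.instance Definition _ := Topological.on sphere.

Lemma sphere_base_subproof : ((1, 0) : R * U) \in sphere_set.
Proof. by rewrite inE /sphere_set/= normr0 expr0n addr0 expr1n. Qed.

Definition sphere_base : sphere := exist _ (1, 0) sphere_base_subproof.

Lemma sphere_act_subproof (g : E) (x : sphere) :
  ((\val x).1, act g (\val x).2) \in sphere_set.
Proof.
by move: (valP x); rewrite !inE /sphere_set/= norm_act.
Qed.

Definition sphere_act (g : E) (x : sphere) : sphere :=
  exist _ ((\val x).1, act g (\val x).2) (sphere_act_subproof g x).

Lemma sphere_act_continuous (g : E) : continuous (sphere_act g).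
Proof.
apply: (@continuous_comp_initial _ sphere (R * U)%type set_val) => x.
have vx : {for x, continuous (set_val : sphere -> R * U)}.
  exact: initial_continuous.
have fst_cvg : (set_val y).1 @[y --> x] --> (set_val x).1.
  by apply: (cvg_comp _ _ vx); exact: cvg_fst.
have snd_cvg : act g (set_val y).2 @[y --> x] --> act g (set_val x).2.
  apply: (@continuous_comp _ _ _ (fun y : sphere => (set_val y).2)).
    by apply: (cvg_comp _ _ vx); exact: cvg_snd.
  exact: act_continuous.
exact: (cvg_pair fst_cvg snd_cvg).
Qed.

Lemma sphere_act_base (g : E) : sphere_act g sphere_base = sphere_base.
Proof.
by apply: val_inj; rewrite /= /act (linear0 (emod_act U g)).
Qed.

(* map_*(S(R (+) U), R), with the topology induced by the compact-open one. *)
Definition pointed_map_set : set {compact-open, sphere -> R} :=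
  [set phi | continuous (phi : sphere -> R) /\ phi sphere_base = 0].

Definition pointed_map : Type := set_type pointed_map_set.

HB.instance Definition _ := Topological.on pointed_map.

Lemma pointed_map_act_subproof (g : E) (phi : pointed_map) :
  (\val phi \o sphere_act (- g)) \in pointed_map_set.
Proof.
have /set_mem[cphi phi0] := valP phi; apply/mem_set; split; last first.
  by rewrite /= sphere_act_base.
by move=> x; apply: continuous_comp; [exact: sphere_act_continuous|exact: cphi].
Qed.

Definition pointed_map_act (g : E) (phi : pointed_map) : pointed_map :=
  exist _ (\val phi \o sphere_act (- g)) (pointed_map_act_subproof g phi).

End EuclideanNorm.

Arguments eigenset {R E} U alpha.
Arguments fixed_points {R E} U.
Arguments pointed_map {R E} U.

Section EquivariantSets.
Context {E : lmodType 'F_2} {X : Type} (a : E -> X -> X).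

Definition invariant_set (K : set X) := forall g x, K x -> K (a g x).

Definition acts_freely_on (K : set X) :=
  forall g x, K x -> a g x = x -> g = 0.

End EquivariantSets.

Section CoveringDimension.
Context (X : topologicalType).

Definition open_cover (C : set (set X)) :=
  (forall A, C A -> open A) /\ \bigcup_(A in C) A = setT.

Definition refines (D C : set (set X)) :=
  forall B, D B -> exists2 A, C A & B `<=` A.

Definition covering_dim_le (n : nat) :=
  forall C, open_cover C -> exists D, [/\ open_cover D, refines D C &
    forall x, [set B | D B /\ B x] #<= `I_n.+1].

(* The empty space has dimension -1, so that it is excluded even for d = 0. *)
Definition covering_dim_ge (d : nat) :=
  [set: X] !=set0 /\ forall n, covering_dim_le n -> (d <= n)%N.

End CoveringDimension.

(* Main.v *)
(* Choose pairwise orthogonal eigenvectors v_i of U whose characters a_i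
   separate E.  The functions (t, u) |-> sum_(l, i) M_(l, i) p_l(t) <u, v_i>,
   with p_l Lagrange polynomials, embed the E-module of (n+1) x r matrices M in
   the mapping space.  The matrices of norm at most 1 having a row bounded away
   from 0 in all entries form a compact free E-space X, which contains the join
   of n + 1 copies of E; K is the zero set of f on X.

   Borsuk-Ulam: let s_j : X -> F_2 satisfy s_j(g x) = s_j(x) + b_j(g) with
   b_j <> 0 for j < n.  Then at some point of X no s_j is locally constant.
   Otherwise the cup product of the coboundaries d s_j vanishes on small
   simplices.  Pick g_i in E and let c_k, for a multi-index k, be the chains of
   the join with boundary d c_k = sum_i (1 + g_i) c_(k - e_i).  By Stokes, that
   cup product takes on every iterated barycentric subdivision of c_k the value
   of the coefficient of x^k in prod_j (sum_i b_j(g_i) x_i), and this product of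
   nonzero linear forms over F_2 is not 0.

   Dimension: write V as a sum of nontrivial characters; the signs of the
   components of f give functions s_j, one of which is locally constant where
   f is nonzero.  If K had dimension less than d, an open cover of order at most
   d would provide further functions s_j, their number depending only on d and
   E, one of which is locally constant at each point of K.  For n large this
   contradicts the Borsuk-Ulam statement. *)

From HB Require Import structures.
From mathcomp Require Import all_boot all_order all_algebra finmap.
From mathcomp Require Import all_classical all_reals all_analysis.
From mathcomp Require Import ring lra zify.
Require Import Defs.
Set Implicit Arguments.
Unset Strict Implicit.
Unset Printing Implicit Defensive.
Import Order.TTheory GRing.Theory Num.Theory.
Import numFieldNormedType.Exports.
Local Open Scope classical_set_scope.
Local Open Scope ring_scope.

(** * Cochains modulo 2 *)

Lemma addF2 (x : 'F_2) : x + x = 0.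
Proof. by rewrite -mulr2n -mulr_natr pchar_Zp ?mulr0. Qed.

Lemma F2_eq1 (x : 'F_2) : x != 0 -> x = 1.
Proof. by case: x => -[|[|//]] i // _; apply: val_inj. Qed.

Section Cochains.
Variable W : eqType.
Implicit Types (phi psi : seq W -> 'F_2) (sigma tau : seq W) (n : nat).

(** The value of [phi] on the boundary: the face opposite the first vertex, plus that vertex joined
    to the faces of the rest. The complex is augmented: the empty simplex is the face of a
    vertex. *)
Fixpoint cobd phi sigma : 'F_2 :=
  if sigma is v :: tau then phi tau + cobd (fun rho => phi (v :: rho)) tau
  else 0.

Lemma cobd_eq phi psi sigma :
  (forall tau, size tau = (size sigma).-1 -> {subset tau <= sigma} ->
     phi tau = psi tau) ->
  cobd phi sigma = cobd psi sigma.
Proof.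
elim: sigma phi psi => [//|v sigma IH] phi psi H /=.
rewrite (H sigma) //=; last by move=> x xs; rewrite inE xs orbT.
congr (_ + _); case: sigma IH H => [//|u sigma] IH H.
apply: IH => tau st sub; apply: H => /=; first by rewrite st.
by move=> x; rewrite !inE => /orP[->//|/sub]; rewrite inE => ->; rewrite orbT.
Qed.

Lemma cobdD phi psi sigma :
  cobd (fun tau => phi tau + psi tau) sigma = cobd phi sigma + cobd psi sigma.
Proof.
elim: sigma phi psi => [|v sigma IH] phi psi /=; first by rewrite addr0.
by rewrite IH addrACA.
Qed.

Lemma cobd_scale (a : 'F_2) phi sigma :
  cobd (fun tau => a * phi tau) sigma = a * cobd phi sigma.
Proof.
elim: sigma phi => [|v sigma IH] phi /=; first by rewrite mulr0.
by rewrite IH mulrDr.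
Qed.

Lemma cobd_cobd phi sigma : cobd (cobd phi) sigma = 0.
Proof.
elim: sigma phi => [//|v sigma IH] phi /=.
by rewrite cobdD IH addr0 addF2.
Qed.

Lemma cobd_map (T : W -> W) phi sigma :
  cobd phi (map T sigma) = cobd (fun tau => phi (map T tau)) sigma.
Proof. by elim: sigma phi => [//|v sigma IH] phi /=; rewrite IH. Qed.

(* The cup product of the coboundaries of the 0-cochains s 0, ..., s n.-1. *)
Fixpoint cup_cobd n (s : nat -> W -> 'F_2) sigma : 'F_2 :=
  if n is m.+1 then
    if sigma is v :: (w :: _) as tau
    then (s 0%N v + s 0%N w) * cup_cobd m (fun j => s j.+1) tau else 0
  else 1.

Definition cup0 (f : W -> 'F_2) phi sigma : 'F_2 :=
  if sigma is v :: _ then f v * phi sigma else 0.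

(** Leibniz rule for the cup product with a 0-cochain. *)
Lemma cobd_cup0 f phi v w sigma :
  cobd (cup0 f phi) (v :: w :: sigma) =
  (f v + f w) * phi (w :: sigma) + f v * cobd phi (v :: w :: sigma).
Proof.
have -> : cobd (cup0 f phi) (v :: w :: sigma) = f w * phi (w :: sigma) +
    cobd (fun tau => f v * phi (v :: tau)) (w :: sigma) by [].
rewrite cobd_scale.
have -> : cobd phi (v :: w :: sigma) =
  phi (w :: sigma) + cobd (fun tau => phi (v :: tau)) (w :: sigma) by [].
set A := phi _; set B := cobd _ _.
rewrite [RHS](_ : _ = f w * A + f v * B + (f v * A + f v * A)); last by ring.
by rewrite addF2 addr0.
Qed.

(** For n > 0 the product agrees on each face, by induction, with the coboundary of a [cup0], and
    [cobd_cobd] applies. *)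
Lemma cobd_cup_cobd n s sigma :
  size sigma = n.+2 -> cobd (cup_cobd n s) sigma = 0.
Proof.
elim: n s sigma => [|n IH] s sigma.
  by case: sigma => [//|v [//|w []]] //= _; rewrite addr0 addF2.
move=> ss; rewrite (@cobd_eq _ (cobd (cup0 (s 0%N) (cup_cobd n (s \o succn))))).
  exact: cobd_cobd.
move=> [|v [|w tau]]; rewrite ?ss // => -[st] _.
by rewrite cobd_cup0 IH ?mulr0 ?addr0 //= st.
Qed.

(** A primitive of the product, to which Stokes is applied in [join_chain_cup_cobd]. *)
Lemma cup_cobdS n s sigma : size sigma = n.+2 ->
  cup_cobd n.+1 s sigma = cobd (cup0 (s 0%N) (cup_cobd n (s \o succn))) sigma.
Proof.
case: sigma => [|v [|w sigma]] // [ss].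
by rewrite cobd_cup0 cobd_cup_cobd ?mulr0 ?addr0 //= ss.
Qed.

Lemma cup_cobd_const n s sigma j : size sigma = n.+1 -> (j < n)%N ->
  {in sigma &, forall u v, s j u = s j v} -> cup_cobd n s sigma = 0.
Proof.
elim: n s sigma j => [//|n IH] s [|v [|w sigma]] j //= [ss].
case: j => [_|j jn] H.
  by rewrite (H v w) ?inE ?eqxx ?orbT // addF2 mul0r.
rewrite (IH _ (w :: sigma) j) ?mulr0 //= ?ss //.
by move=> a b ha hb; apply: H; rewrite inE (ha, hb) orbT.
Qed.
End Cochains.

(** Modulo 2 the terms at (i, j) and (j, i) cancel. In [join_chain_cobd] this makes an iterated
    boundary vanish. *)
Lemma sumF2_sym q (a : 'I_q -> 'I_q -> 'F_2) :
  (forall i j, a i j = a j i) -> (forall i, a i i = 0) ->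
  \sum_i \sum_j a i j = 0.
Proof.
move=> aC a0.
have -> : \sum_i \sum_j a i j =
    \sum_(i < q) \sum_(j < q | (j < i)%N) a i j +
    \sum_(i < q) \sum_(j < q | (i < j)%N) a i j.
  rewrite -big_split; apply: eq_bigr => i _ /=.
  rewrite (bigD1 i) //= a0 add0r (bigID (fun j : 'I_q => (j < i)%N)) /=.
  by congr (_ + _); apply: eq_bigl => j; rewrite -val_eqE; case: ltngtP.
rewrite [X in _ + X](exchange_big_dep predT) //=.
rewrite -[RHS](addF2 (\sum_(i < q) \sum_(j < q | (j < i)%N) a i j)); congr (_ + _).
by apply: eq_bigr => i _; apply: eq_bigr => j _.
Qed.

(** * Chains of the join *)

Section Chains.
Variables (W : eqType) (q : nat) (w : nat -> W) (T : nat -> W -> W).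
Hypothesis TK : forall i, involutive (T i).
Hypothesis TC : forall i j x, T i (T j x) = T j (T i x).
Implicit Types (phi psi : seq W -> 'F_2) (sigma tau : seq W) (k : nat -> nat).

Definition decr k i : nat -> nat := fun j => (k j - (j == i))%N.

(* Evaluation on the chains c_k of the join of the orbits of w 0, w 1, ...
   defined by c_k = w_{|k|} * (sum_i (1 + T i) c_{k - e_i}). *)
Fixpoint join_chain n k phi : 'F_2 :=
  if n is m.+1 then
    \sum_(i < q | (0 < k i)%N)
      (join_chain m (decr k i) (fun tau => phi (w n :: tau)) +
       join_chain m (decr k i) (fun tau => phi (w n :: map (T i) tau)))
  else phi [:: w 0%N].

(** A superset of the simplices of the chains c_k with |k| = n: the multi-index and the bound on i
    are dropped. *)
Fixpoint join_simplex n sigma : Prop :=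
  if n is m.+1 then
    exists2 tau, join_simplex m tau &
      sigma = w n :: tau \/ exists i, sigma = w n :: map (T i) tau
  else sigma = [:: w 0%N].

Lemma join_chain_eq n k phi psi :
  (forall sigma, join_simplex n sigma -> phi sigma = psi sigma) ->
  join_chain n k phi = join_chain n k psi.
Proof.
elim: n k phi psi => [|n IH] k phi psi H /=; first by rewrite H.
apply: eq_bigr => i _; congr (_ + _); apply: IH => tau Ht; apply: H.
  by exists tau => //; left.
by exists tau => //; right; exists (nat_of_ord i).
Qed.

Lemma join_chainD n k phi psi :
  join_chain n k (fun tau => phi tau + psi tau) =
  join_chain n k phi + join_chain n k psi.
Proof.
elim: n k phi psi => [|n IH] k phi psi //=.
rewrite -big_split; apply: eq_bigr => i _ /=.
by rewrite !IH addrACA.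
Qed.

Lemma join_chain_scale (a : 'F_2) n k phi :
  join_chain n k (fun tau => a * phi tau) = a * join_chain n k phi.
Proof.
elim: n k phi => [|n IH] k phi //=.
by rewrite mulr_sumr; apply: eq_bigr => i _; rewrite !IH mulrDr.
Qed.

Lemma decrC k i j : decr (decr k i) j =1 decr (decr k j) i.
Proof. by move=> l; rewrite /decr subnAC. Qed.

Lemma join_chain_eqk n k k' phi :
  k =1 k' -> join_chain n k phi = join_chain n k' phi.
Proof.
elim: n k k' phi => [//|n IH] k k' phi kk' /=.
apply: eq_big => [i|i _]; first by rewrite kk'.
by congr (_ + _); apply: IH => j; rewrite /decr kk'.
Qed.

Lemma decr_gt0C k i j :
  (0 < k i)%N && (0 < decr k i j)%N = (0 < k j)%N && (0 < decr k j i)%N.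
Proof. by rewrite /decr (eq_sym j); case: (eqVneq i j) => [->//|ij]; lia. Qed.

Lemma join_chainS n k phi : join_chain n.+1 k phi =
  \sum_(i < q | (0 < k i)%N)
    (join_chain n (decr k i) (fun tau => phi (w n.+1 :: tau)) +
     join_chain n (decr k i) (fun tau => phi (w n.+1 :: map (T i) tau))).
Proof. by []. Qed.

Local Arguments join_chain : simpl never.

(** Write c_k as the cone w z over z = sum_i (1 + T_i) c_(k - e_i). Its boundary is z + w dz, and dz
    = sum_(i, j) (1 + T_i)(1 + T_j) c_(k - e_i - e_j) vanishes: the T_i commute, so terms off the
    diagonal cancel in pairs, and (1 + T_i)^2 = 1 + T_i^2 = 0 modulo 2. *)
Lemma join_chain_cobd n k phi :
  join_chain n.+1 k (cobd phi) =
  \sum_(i < q | (0 < k i)%N) (join_chain n (decr k i) phi +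
     join_chain n (decr k i) (fun tau => phi (map (T i) tau))).
Proof.
elim: n k phi => [|n IH] k phi.
  apply: eq_bigr => i _; rewrite /join_chain /= !addr0.
  by rewrite addrACA addF2 addr0.
set psi := fun tau => phi (w n.+2 :: tau).
transitivity (\sum_(i < q | (0 < k i)%N) (join_chain n.+1 (decr k i) phi +
     join_chain n.+1 (decr k i) (fun tau => phi (map (T i) tau))) +
  \sum_(i < q | (0 < k i)%N) (join_chain n.+1 (decr k i) (cobd psi) +
     join_chain n.+1 (decr k i) (cobd (fun tau => psi (map (T i) tau))))).
  rewrite join_chainS -big_split; apply: eq_bigr => i _ /=; rewrite addrACA.
  rewrite -[in RHS]join_chainD -[in RHS]join_chainD.
  congr (_ + _); apply: join_chain_eq => tau _ //=.
  by rewrite cobd_map.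
rewrite [X in _ + X](_ : _ = 0) ?addr0 //.
pose P i j := (0 < k i)%N && (0 < decr k i j)%N.
pose J i j chi := join_chain n (decr (decr k i) j) chi.
(* The value of [psi] on (1 + T_i)(1 + T_j) c_(k - e_i - e_j). *)
pose a (i j : 'I_q) := if P i j then (J i j psi +
  J i j (fun tau => psi (map (T j) tau))) +
  (J i j (fun tau => psi (map (T i) tau)) +
   J i j (fun tau => psi (map (T i) (map (T j) tau)))) else 0.
rewrite -[RHS](@sumF2_sym _ a); first last.
- move=> i; rewrite /a; case: ifP => // _.
  rewrite [X in _ + (_ + X)](_ : _ = J i i psi); first by rewrite addrC [J i i psi + _]addrC addF2.
  by apply: join_chain_eq => tau _; rewrite mapK //; exact: TK.
- move=> i j; rewrite /a /P decr_gt0C; case: ifP => // _.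
  have JC chi : J i j chi = J j i chi.
    by apply: join_chain_eqk; exact: decrC.
  rewrite !JC addrACA; congr (_ + _ + _); congr (_ + _).
  apply: join_chain_eq => tau _; congr psi; rewrite -!map_comp.
  by apply: eq_map => x; exact: TC.
rewrite big_mkcond; apply: eq_bigr => i _.
case: ifPn => ki; last first.
  by rewrite big1 // => j _; rewrite /a /P (negPf ki).
rewrite !IH -big_split big_mkcond; apply: eq_bigr => j _.
by rewrite /a /P ki.
Qed.
End Chains.

(** * Barycentric subdivision *)

Section Subdivision.
Variables (R : realType) (W : normedModType R).
Implicit Types (phi psi : seq W -> 'F_2) (sigma tau : seq W) (T : {linear W -> W}).

Definition bary sigma : W := (size sigma)%:R^-1 *: \sum_(v <- sigma) v.

(* Dual to barycentric subdivision sd, sd sigma = bary sigma * sd (d sigma). *)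
Fixpoint sdn n phi sigma : 'F_2 :=
  if n is m.+1 then cobd (sdn m (fun tau => phi (bary sigma :: tau))) sigma
  else phi [::].

Definition sd phi sigma := sdn (size sigma) phi sigma.

Lemma sdnD n phi psi sigma :
  sdn n (fun tau => phi tau + psi tau) sigma = sdn n phi sigma + sdn n psi sigma.
Proof.
elim: n phi psi sigma => [//|n IH] phi psi sigma /=.
rewrite -cobdD; apply: cobd_eq => tau _ _; exact: IH.
Qed.

Lemma sdn_scale (a : 'F_2) n phi sigma :
  sdn n (fun tau => a * phi tau) sigma = a * sdn n phi sigma.
Proof.
elim: n phi sigma => [//|n IH] phi sigma /=.
rewrite -cobd_scale; apply: cobd_eq => tau _ _; exact: IH.
Qed.

(** Subdivision is a chain map: the boundary of the cone over sd (d sigma) is sd (d sigma) plus the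
    cone over d sd (d sigma), which by induction is sd (d d sigma) = 0. *)
Lemma sdn_cobd n phi sigma :
  size sigma = n.+1 -> sdn n.+1 (cobd phi) sigma = cobd (sdn n phi) sigma.
Proof.
elim: n phi sigma => [|n IH] phi sigma ss.
  by rewrite /= (@cobd_eq _ _ (fun=> phi [::])) // => tau _ _; rewrite addr0.
set psi := fun tau => phi (bary sigma :: tau).
have -> : sdn n.+2 (cobd phi) sigma =
  cobd (fun tau => sdn n.+1 phi tau + sdn n.+1 (cobd psi) tau) sigma.
  rewrite [LHS]/=; apply: (@cobd_eq _ (sdn n.+1 (fun tau => phi tau + cobd psi tau))).
  by move=> tau _ _; exact: sdnD.
rewrite cobdD [X in _ + X](_ : _ = 0) ?addr0 //.
rewrite -[RHS](cobd_cobd (sdn n psi) sigma); apply: cobd_eq => tau st _.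
by rewrite IH // st ss.
Qed.

Lemma sd_cobd phi sigma : sd (cobd phi) sigma = cobd (sd phi) sigma.
Proof.
rewrite /sd; case ss: (size sigma) => [|n]; first by case: sigma ss.
rewrite sdn_cobd //; apply: cobd_eq => tau st _; by rewrite st ss.
Qed.

Lemma bary_map T sigma : bary (map T sigma) = T (bary sigma).
Proof.
rewrite /bary size_map big_map linearZ_LR; congr (_ *: _).
by rewrite raddf_sum.
Qed.

Lemma sdn_map T n phi sigma :
  sdn n phi (map T sigma) = sdn n (fun tau => phi (map T tau)) sigma.
Proof.
elim: n phi sigma => [//|n IH] phi sigma /=.
rewrite cobd_map; apply: cobd_eq => tau _ _.
by rewrite IH bary_map.
Qed.

Lemma sd_map T phi sigma :
  sd phi (map T sigma) = sd (fun tau => phi (map T tau)) sigma.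
Proof. by rewrite /sd size_map sdn_map. Qed.

(** A substitute for convexity: subdivision only forms barycentres of lists of vertices. *)
Definition bary_closed (C : set W) :=
  forall sigma, (0 < size sigma)%N -> (forall v, v \in sigma -> C v) ->
    C (bary sigma).

Definition mesh_le (rho : R) sigma :=
  forall u v, u \in sigma -> v \in sigma -> `|u - v| <= rho.

(** What is retained about a simplex of a subdivision: its dimension, its position in the hull of
    [sigma], and the contraction of the mesh. *)
Definition subdivides (c : R) sigma tau :=
  [/\ size tau = size sigma,
      forall C, bary_closed C -> (forall v, v \in sigma -> C v) ->
        forall v, v \in tau -> C v &
      forall rho, mesh_le rho sigma -> mesh_le (c * rho) tau].

Lemma bary_closed_ball (x : W) (rho : R) :
  bary_closed [set y | `|x - y| <= rho].
Proof.
move=> sigma s0 H /=.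
have n0 : 0 < (size sigma)%:R :> R by rewrite ltr0n.
have -> : x - bary sigma = (size sigma)%:R^-1 *: \sum_(v <- sigma) (x - v).
  rewrite sumrB big_const_seq count_predT iter_addr_0 scalerBr.
  by rewrite -[x *+ _]scaler_nat scalerA mulVf ?gt_eqF // scale1r.
rewrite normrZ ger0_norm ?invr_ge0 ?ler0n // ler_pdivrMl //.
apply: le_trans (ler_norm_sum _ _ _) _.
rewrite big_seq; apply: le_trans (ler_sum _ (G := fun=> rho) H) _.
by rewrite -big_seq big_const_seq count_predT iter_addr_0 mulr_natl.
Qed.

(** Among the differences v - u to be averaged one is zero, whence the factor (k - 1)/k for k
    vertices. *)
Lemma bary_dist (rho : R) sigma u : mesh_le rho sigma -> u \in sigma ->
  `|bary sigma - u| <= (size sigma).-1%:R / (size sigma)%:R * rho.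
Proof.
move=> H us.
have s0 : (0 < size sigma)%N by case: sigma us {H}.
have n0 : 0 < (size sigma)%:R :> R by rewrite ltr0n.
have -> : bary sigma - u = (size sigma)%:R^-1 *: \sum_(v <- sigma) (v - u).
  rewrite sumrB big_const_seq count_predT iter_addr_0 scalerBr.
  by rewrite -[u *+ _]scaler_nat scalerA mulVf ?gt_eqF // scale1r.
rewrite normrZ ger0_norm ?invr_ge0 ?ler0n // mulrAC ler_pdivlMr // mulrAC mulVf ?gt_eqF // mul1r.
apply: le_trans (ler_norm_sum _ _ _) _.
rewrite (big_rem u) //= subrr normr0 add0r big_seq.
apply: le_trans (ler_sum _ (G := fun=> rho) _) _.
  by move=> v /mem_rem vs; apply: H.
by rewrite -big_seq big_const_seq count_predT iter_addr_0 size_rem // mulr_natl.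
Qed.

(** Two vertices of [tau] other than the barycentre of [sigma] are treated by induction on a face.
    Distances from the barycentre are bounded by [bary_dist], where k <= N + 1 vertices give (k -
    1)/k <= N/(N + 1). *)
Lemma sdn_eq N n phi psi sigma : size sigma = n -> (n <= N.+1)%N ->
  (forall tau, subdivides (N%:R / N.+1%:R) sigma tau -> phi tau = psi tau) ->
  sdn n phi sigma = sdn n psi sigma.
Proof.
elim: n phi psi sigma => [|n IH] phi psi sigma ss nN H /=.
  by apply: H; split=> //; case: sigma ss.
apply: cobd_eq => tau st sub; apply: IH.
- by rewrite st ss.
- exact: ltnW.
move=> tau' [st' hull mesh]; apply: H; split.
- by rewrite /= st' st ss.
- move=> C Cb Cs v; rewrite inE => /orP[/eqP->|].
    by apply: Cb => //; rewrite ss.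
  by apply: hull => // u /sub; exact: Cs.
move=> rho Hrho.
have near_b v : v \in bary sigma :: tau' ->
    `|bary sigma - v| <= N%:R / N.+1%:R * rho.
  rewrite inE => /orP[/eqP->|].
    rewrite subrr normr0 mulr_ge0 ?divr_ge0 //.
    case: sigma ss Hrho {sub st} => [//|u sigma] _ /(_ u u).
    by rewrite subrr normr0; apply; rewrite inE eqxx.
  (* A ball is [bary_closed], so it contains the vertices of [tau'] once it contains those of the
     face [tau]. *)
  apply: (hull [set y | `|bary sigma - y| <= N%:R / N.+1%:R * rho]).
    exact: bary_closed_ball.
  move=> u /sub us /=; apply: le_trans (bary_dist Hrho us) _.
  apply: ler_wpM2r.
    by apply: le_trans (Hrho _ _ us us).
  rewrite ss /= ler_pdivrMr ?ltr0n // mulrAC ler_pdivlMr ?ltr0n //.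
  by rewrite -!natrM ler_nat; nia.
move=> u v; rewrite [u \in _]inE => /orP[/eqP->|ut]; first exact: near_b.
rewrite inE => /orP[/eqP->|vt].
  by rewrite distrC near_b // inE ut orbT.
apply: mesh ut vt => a b /sub ha /sub hb; exact: Hrho.
Qed.

Lemma sd_eq N phi psi sigma : (size sigma <= N.+1)%N ->
  (forall tau, subdivides (N%:R / N.+1%:R) sigma tau -> phi tau = psi tau) ->
  sd phi sigma = sd psi sigma.
Proof. by move=> sN; apply: sdn_eq. Qed.

Lemma iter_sd_eq N m phi psi sigma : (size sigma <= N.+1)%N ->
  (forall tau, subdivides ((N%:R / N.+1%:R) ^+ m) sigma tau ->
    phi tau = psi tau) ->
  iter m sd phi sigma = iter m sd psi sigma.
Proof.
elim: m phi psi sigma => [|m IH] phi psi sigma sN H.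
  by apply: H; split => // rho; rewrite expr0 mul1r.
rewrite /=; apply: (@sd_eq N) => // tau [st hull mesh].
apply: IH => [|tau' [st' hull' mesh']]; first by rewrite st.
apply: H; split.
- by rewrite st' st.
- by move=> C Cb Cs; apply: hull' => //; apply: hull.
- by move=> rho /mesh /mesh'; rewrite mulrA -exprSr.
Qed.

Lemma iter_sd_cobd m phi sigma :
  iter m sd (cobd phi) sigma = cobd (iter m sd phi) sigma.
Proof.
elim: m sigma => [//|m IH] sigma /=; rewrite -sd_cobd.
by apply: (@sd_eq (size sigma)) => // tau _; exact: IH.
Qed.

Lemma iter_sd_map T m phi sigma :
  iter m sd phi (map T sigma) = iter m sd (fun tau => phi (map T tau)) sigma.
Proof.
elim: m sigma => [//|m IH] sigma /=; rewrite sd_map.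
by apply: (@sd_eq (size sigma)) => // tau _; exact: IH.
Qed.

Lemma iter_sdD m phi psi sigma :
  iter m sd (fun tau => phi tau + psi tau) sigma =
  iter m sd phi sigma + iter m sd psi sigma.
Proof.
elim: m sigma => [//|m IH] sigma /=; rewrite -sdnD.
by apply: (@sd_eq (size sigma)) => // tau _; exact: IH.
Qed.

Lemma iter_sd_scale (a : 'F_2) m phi sigma :
  iter m sd (fun tau => a * phi tau) sigma = a * iter m sd phi sigma.
Proof.
elim: m sigma => [//|m IH] sigma /=; rewrite -sdn_scale.
by apply: (@sd_eq (size sigma)) => // tau _; exact: IH.
Qed.
End Subdivision.

(** * The cup product on the join *)

Section MonomialCoefficient.
Variable q : nat.
Implicit Types (b : nat -> nat -> 'F_2) (k m : nat -> nat).

(* The coefficient of x^k in the product over j < n of sum_(i < q) b j i x_i. *)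
Fixpoint mono_coef n b k : 'F_2 :=
  if n is n'.+1 then
    \sum_(i < q | (0 < k i)%N) b 0%N i * mono_coef n' (fun j => b j.+1) (decr k i)
  else 1.

Lemma mono_coef_eqk n b k k' : k =1 k' -> mono_coef n b k = mono_coef n b k'.
Proof.
elim: n b k k' => [//|n IH] b k k' kk' /=.
apply: eq_big => [i|i _]; first by rewrite kk'.
by congr (_ * _); apply: IH => j; rewrite /decr kk'.
Qed.

Let weight k : nat := (\sum_(i < q) i * k i)%N.

Lemma weight_decr k (i : 'I_q) : (0 < k i)%N ->
  weight k = (weight (decr k i) + i)%N.
Proof.
move=> ki; rewrite /weight (bigD1 i) //= [X in (_ = X + _)%N](bigD1 i) //=.
rewrite (eq_bigr (fun j : 'I_q => (j * decr k i j)%N)).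
  by rewrite /decr eqxx -addnAC -mulnSr subn1 prednK.
by move=> j ji; rewrite /decr val_eqE (negPf ji) subn0.
Qed.

(** With weight i given to x_i, the form [j] only involves variables of weight at least [m j], so
    every monomial of the product has weight at least the sum of the [m j]. *)
Lemma mono_coef_eq0 n b m k : (forall j i, (i < m j)%N -> b j i = 0) ->
  (weight k < \sum_(j < n) m j)%N -> mono_coef n b k = 0.
Proof.
elim: n b m k => [|n IH] b m k bm; first by rewrite big_ord0.
rewrite big_ord_recl /= => kw; apply: big1 => i ki.
have [im|mi] := ltnP i (m 0%N); first by rewrite bm ?mul0r.
rewrite (IH _ (fun j => m j.+1)) ?mulr0 // => [j l|]; first exact: bm.
by move: kw; rewrite (weight_decr ki) -[\sum_(j < n) m j.+1]/(\sum_(j < n) m (bump 0 j)); lia.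
Qed.

(* The monomial of least weight, the product of the x_(m j), occurs once. *)
Lemma mono_coef_lead n b m : (forall j i, (i < m j)%N -> b j i = 0) ->
  (forall j, b j (m j) = 1) -> (forall j, (m j < q)%N) ->
  mono_coef n b (fun i => \sum_(j < n) (m j == i))%N = 1.
Proof.
elim: n b m => [//|n IH] b m bm b1 mq.
set k := fun i => _; rewrite /=.
have kE i : k i = ((m 0%N == i) + \sum_(j < n) (m j.+1 == i))%N.
  by rewrite /k big_ord_recl.
have km : (0 < k (m 0%N))%N by rewrite kE eqxx.
rewrite (bigD1 (Ordinal (mq 0%N))) //= b1 mul1r.
rewrite (mono_coef_eqk _ _ (k' := fun i => \sum_(j < n) (m j.+1 == i))%N); last first.
  by move=> i; rewrite /decr kE eq_sym addKn.
rewrite (IH _ (fun j => m j.+1)) // => [|j i]; last exact: bm.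
rewrite big1 ?addr0 // => i /andP[ki]; rewrite -val_eqE /= => im.
have [lt|le] := ltnP i (m 0%N); first by rewrite bm ?mul0r.
rewrite (@mono_coef_eq0 n _ (fun j => m j.+1)) ?mulr0 // => [j l|]; first exact: bm.
have : weight k = (\sum_(j < n.+1) m j)%N.
  rewrite /weight /k.
  under eq_bigr do rewrite big_distrr /=.
  rewrite exchange_big /=; apply: eq_bigr => j _.
  rewrite (bigD1 (Ordinal (mq j))) //= eqxx muln1 big1 ?addn0 // => l.
  by rewrite -val_eqE /= eq_sym => /negPf->; rewrite muln0.
rewrite (weight_decr ki) big_ord_recl /=.
rewrite -[\sum_(j < n) m j.+1]/(\sum_(j < n) m (bump 0 j)).
have: (m 0%N < i)%N by rewrite ltn_neqAle eq_sym im.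
lia.
Qed.

(** Take for [m j] the least index of a nonzero coefficient of the form [j]; over F_2 that
    coefficient is 1. *)
Lemma ex_mono_coef n b : (forall j, exists2 i, (i < q)%N & b j i != 0) ->
  exists k, mono_coef n b k = 1.
Proof.
move=> H.
have H' j : exists i, (i < q)%N && (b j i != 0).
  by have [i iq bi] := H j; exists i; rewrite iq.
pose m j := ex_minn (H' j).
have mP j : [/\ (m j < q)%N, b j (m j) != 0 & forall i, (i < m j)%N -> b j i = 0].
  rewrite /m; case: ex_minnP => i /andP[iq bi] min; split=> // l li.
  apply/eqP/negP => /negP bl; have := li; rewrite ltnNge min //.
  by rewrite bl andbT; apply: ltn_trans iq.
exists (fun i => \sum_(j < n) (m j == i))%N; apply: mono_coef_lead => j.
- by have [] := mP j.
- by have [_ /F2_eq1] := mP j.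
- by have [] := mP j.
Qed.
End MonomialCoefficient.

Section JoinEvaluation.
Variables (R : realType) (W : normedModType R) (q : nat) (w : nat -> W).
Variable T : nat -> {linear W -> W}.
Hypothesis TK : forall i, involutive (T i).
Hypothesis TC : forall i j x, T i (T j x) = T j (T i x).
Variables (X : set W) (N : nat).
(** [X] need not be convex; this keeps all iterated subdivisions of the simplices of the join inside
    [X]. *)
Hypothesis simplex_hull : forall n sigma, (n <= N)%N ->
  join_simplex w (fun i => T i) n sigma ->
  exists2 C, bary_closed C & C `<=` X /\ forall v, v \in sigma -> C v.
Implicit Types (s : nat -> W -> 'F_2) (b : nat -> nat -> 'F_2) (sigma tau : seq W).

Let chain := join_chain q w (fun i => T i).

Lemma size_join_simplex (S : nat -> W -> W) n sigma :
  join_simplex w S n sigma -> size sigma = n.+1.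
Proof.
elim: n sigma => [|n IH] sigma /=; first by move=> ->.
by case=> tau /IH st [->|[i ->]]; rewrite /= ?size_map st.
Qed.

(** Both ends of an edge have their value of [s j] shifted by the same [b j i], so the differences
    stay. *)
Lemma cup_cobd_map n s b i tau :
  (forall j x, X x -> s j (T i x) = s j x + b j i) ->
  size tau = n.+1 -> (forall v, v \in tau -> X v) ->
  cup_cobd n s (map (T i) tau) = cup_cobd n s tau.
Proof.
elim: n s b tau => [//|n IH] s b [|v [|u tau]] //= sT [st] tX.
rewrite !sT; last 2 first.
- by apply: tX; rewrite !inE eqxx orbT.
- by apply: tX; rewrite inE eqxx.
rewrite addrACA addF2 addr0; congr (_ * _).
apply: (IH (fun j => s j.+1) (fun j => b j.+1) (u :: tau)) => //=.
- by move=> j x; apply: sT.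
- by rewrite st.
- by move=> x xt; apply: tX; rewrite inE xt orbT.
Qed.

Lemma iter_sd_cup0 m s sigma : size sigma = 1%N ->
  iter m (@sd R W) (cup_cobd 0 s) sigma = 1.
Proof.
elim: m sigma => [//|m IH] sigma ss /=.
by rewrite /sd ss /=; case: sigma ss => [|v []] //= _; rewrite IH // addr0.
Qed.

(** By Stokes the value is that of the cup product of s_0 with P on sum_i (1 + T_i) c_(k - e_i),
    where P is the product of the other coboundaries. Since T_i preserves P and shifts s_0 by
    [b 0 i], the term i is [b 0 i] times the value of P on c_(k - e_i), which is the recursion of
    [mono_coef]. *)
Lemma join_chain_cup_cobd n s b k m : (n <= N)%N ->
  (forall j i x, X x -> s j (T i x) = s j x + b j i) ->
  chain n k (iter m (@sd R W) (cup_cobd n s)) = mono_coef q n b k.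
Proof.
elim: n s b k => [|n IH] s b k nN sT.
  by rewrite /chain /= iter_sd_cup0.
pose s' j := s j.+1; pose Q := cup0 (s 0%N) (cup_cobd n s').
have -> : chain n.+1 k (iter m (@sd R W) (cup_cobd n.+1 s)) =
    chain n.+1 k (cobd (iter m (@sd R W) Q)).
  apply: join_chain_eq => sigma /size_join_simplex ss.
  rewrite -iter_sd_cobd; apply: (@iter_sd_eq _ _ n.+1) => [|tau [st _ _]].
    by rewrite ss.
  by rewrite cup_cobdS // st.
rewrite /chain join_chain_cobd //=; apply: eq_bigr => i _.
rewrite -join_chainD -(IH s') //; [|exact: ltnW|by move=> j l x; exact: sT].
rewrite -join_chain_scale; apply: join_chain_eq => sigma sj.
rewrite iter_sd_map -iter_sdD -iter_sd_scale.
have ss := size_join_simplex sj.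
apply: (@iter_sd_eq _ _ n) => [|tau [st hull _]]; first by rewrite ss.
have [C Cb [CX Cs]] := simplex_hull (ltnW nN) sj.
have tX v : v \in tau -> X v by move=> vt; apply/CX/(hull C Cb Cs).
rewrite ss in st.
rewrite /Q; case: tau st tX {hull} => [//|v tau] st tX.
rewrite /cup0 /= -/(map (T i) (v :: tau)).
rewrite (@cup_cobd_map n s' (fun j => b j.+1)) // => [|j x]; last exact: sT.
rewrite sT; last by apply: tX; rewrite inE eqxx.
by rewrite mulrDl addrA addF2 add0r.
Qed.
End JoinEvaluation.

(** * Borsuk-Ulam *)

Section LocallyConstant.
Variables (R : realType) (W : normedModType R) (q : nat) (w : nat -> W).
Variable T : nat -> {linear W -> W}.
Hypothesis TK : forall i, involutive (T i).
Hypothesis TC : forall i j x, T i (T j x) = T j (T i x).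
Variables (X : set W) (N : nat).
Hypothesis simplex_hull : forall n sigma, (n <= N)%N ->
  join_simplex w (fun i => T i) n sigma ->
  exists2 C, bary_closed C & C `<=` X /\ forall v, v \in sigma -> C v.

(* A Lusternik-Schnirelmann form of the Borsuk-Ulam theorem. *)
Lemma not_locally_constant (s : nat -> W -> 'F_2) (b : nat -> nat -> 'F_2) :
  compact X -> (exists rho : R, forall x, X x -> `|x| <= rho) ->
  (forall j i x, X x -> s j (T i x) = s j x + b j i) ->
  (forall j, exists2 i, (i < q)%N & b j i != 0) ->
  ~ (forall x, X x -> exists2 j, (j < N)%N &
       \forall y \near x, X y -> s j y = s j x).
Proof.
move=> cX [rho Xrho] sT bN0 sloc.
have [k /esym] := ex_mono_coef N bN0.
(* A Lebesgue number, from compactness: within distance [e] of any point of [X] one of the [s j] is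
   constant on [X]. *)
have [e e0 He] : exists2 e : R, 0 < e & forall x, X x -> exists2 j, (j < N)%N &
    forall y z, X y -> X z -> `|x - y| < e -> `|x - z| < e -> s j y = s j z.
  pose P (e : R) x := exists2 j, (j < N)%N & forall y z, X y -> X z ->
    `|x - y| < e -> `|x - z| < e -> s j y = s j z.
  have HP : \forall e \near (0 : R)^'+, X `<=` P e.
    move/compact_near_coveringP/near_covering_withinP : cX; apply.
    move=> x Xx; have [j jN /nbhs_ballP[d /= d0 Hd]] := sloc x Xx.
    exists (ball x (d / 2), [set e | e < d / 2]); first split => /=.
    - by apply: nbhsx_ballx; rewrite divr_gt0.
    - by apply: nbhs_right_lt; rewrite divr_gt0.
    move=> [x' e] /= [xx' ed] Xx'; exists j => // y z Xy Xz x'y x'z.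
    have near' u : `|x' - u| < e -> ball x d u.
      move=> x'u; rewrite [d]splitr; apply: ball_triangle xx' _.
      by rewrite -ball_normE /=; exact: lt_trans ed.
    by rewrite !Hd //; exact: near'.
  near (0 : R)^'+ => e; exists e; first by near: e; exact: nbhs_right_gt.
  by near: e; exact: HP.
pose c : R := N%:R / N.+1%:R.
have c01 : `|c| < 1.
  rewrite ger0_norm ?divr_ge0 // /c ltr_pdivrMr ?ltr0n // mul1r ltr_nat //.
(* A simplex with vertices in [X] has mesh at most 2 rho; [m] subdivisions bring it below [e]. *)
have [m cm] : exists m, c ^+ m * (rho + rho) < e.
  near \oo => m; exists m; near: m.
  have : (fun m => c ^+ m * (rho + rho)) @ \oo --> (0 * (rho + rho)).
    by apply: cvgMl; exact: cvg_expr.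
  rewrite mul0r => /cvgr_lt; exact.
rewrite -(join_chain_cup_cobd q TK TC simplex_hull k m (leqnn N) sT) => /esym/eqP.
(* The zero cochain is written as a product so that [join_chain_scale] evaluates it. *)
suff -> : join_chain q w (fun i => T i) N k (iter m (@sd R W) (cup_cobd N s)) =
    join_chain q w (fun i => T i) N k (fun=> 0 * 0).
  by rewrite join_chain_scale mul0r eq_sym oner_eq0.
apply: join_chain_eq => sigma sj; rewrite mul0r.
have ss := size_join_simplex sj.
have [C Cb [CX Cs]] := simplex_hull (leqnn N) sj.
transitivity (iter m (@sd R W) (fun tau => 0 * cup_cobd N s tau) sigma); last first.
  by rewrite iter_sd_scale mul0r.
apply: (@iter_sd_eq _ _ N) => [|tau [st hull mesh]]; first by rewrite ss.
rewrite mul0r.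
have tX v : v \in tau -> X v by move=> vt; apply/CX/(hull C Cb Cs).
have [x xt] : exists x, x \in tau.
  by rewrite ss in st; case: tau st {hull mesh tX} => // x tau _; exists x; rewrite inE eqxx.
have [j jN sj'] := He x (tX x xt).
have small u : u \in tau -> `|x - u| < e.
  move=> ut; apply: le_lt_trans cm; apply: mesh => // a b' /Cs/CX/Xrho ha /Cs/CX/Xrho hb.
  by apply: le_trans (ler_normB _ _) _; exact: lerD.
apply: (@cup_cobd_const _ _ _ _ j) => //; first by rewrite st.
by move=> u v ut vt; apply: sj'; rewrite ?small //; exact: tX.
Unshelve. all: by end_near. Qed.
End LocallyConstant.

Lemma near_dist_lt (K : numFieldType) (W : normedModType K) (x : W) (e : K) :
  0 < e -> \forall y \near x, `|x - y| < e.
Proof. by move=> e0; apply/nbhs_ballP; exists e => // y; rewrite -ball_normE. Qed.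

(** * Sign changes and a compact free space of matrices *)

Section Signs.
Variable R : realType.

Definition sgF2 (x : 'F_2) : R := (-1) ^+ x.

Lemma sgF2D x y : sgF2 (x + y) = sgF2 x * sgF2 y.
Proof.
by case: x => -[|[|//]] ?; case: y => -[|[|//]] ?;
  rewrite /sgF2 /= ?expr0 ?expr1 ?mulr1 ?mul1r ?mulrNN ?mulr1.
Qed.

Lemma sgF2_norm x : `|sgF2 x| = 1.
Proof. by rewrite normrX normrN normr1 expr1n. Qed.

Lemma sgF2_sqr x : sgF2 x * sgF2 x = 1.
Proof. by rewrite -expr2 sqrr_sign. Qed.

Lemma sgF2_eq1 x : sgF2 x = 1 -> x = 0.
Proof.
case: x => -[|[|//]] i; rewrite /sgF2 /= ?expr1 => H; apply/val_inj => //=.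
by move/eqP: H; rewrite eq_sym -addr_eq0 paddr_eq0 ?ler01 // oner_eq0.
Qed.

Lemma sgF20 : sgF2 0 = 1.
Proof. by rewrite /sgF2 expr0. Qed.
End Signs.

Section SignAction.
Variables (R : realType) (E : Type) (r : nat) (a : 'I_r -> E -> 'F_2).
Variable n : nat.
Local Notation W := 'M[R]_(n.+1, r).

Definition sgmx (g : E) : {linear W -> W} :=
  mulmxr (diag_mx (\row_i sgF2 R (a i g))).

Lemma sgmxE g (M : W) l i : sgmx g M l i = sgF2 R (a i g) * M l i.
Proof. by rewrite /sgmx /= mul_mx_diag !mxE mulrC. Qed.

Lemma sgmxK g : involutive (sgmx g).
Proof. by move=> M; apply/matrixP => l i; rewrite !sgmxE mulrA sgF2_sqr mul1r. Qed.

Lemma sgmxC g h M : sgmx g (sgmx h M) = sgmx h (sgmx g M).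
Proof. by apply/matrixP => l i; rewrite !sgmxE mulrCA. Qed.

Lemma mx_entry_le (M : W) l i : `|M l i| <= `|M|.
Proof.
rewrite [leRHS]/Num.norm /= mx_normrE.
by apply/bigmax_geP; right => /=; exists (l, i).
Qed.

Lemma mx_norm_le (M : W) (c : R) : 0 <= c ->
  (forall l i, `|M l i| <= c) -> `|M| <= c.
Proof.
move=> c0 H; rewrite [leLHS]/Num.norm /= mx_normrE.
by apply/bigmax_leP; split => // -[l i] _; exact: H.
Qed.

Lemma norm_sgmx g M : `|sgmx g M| = `|M|.
Proof.
have le g' M' : `|sgmx g' M'| <= `|M'|.
  apply: mx_norm_le => // l i; rewrite sgmxE normrM sgF2_norm mul1r.
  exact: mx_entry_le.
by apply/eqP; rewrite eq_le le /= -{1}(sgmxK g M) le.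
Qed.

(* The join of n.+1 copies of the group is the part of this set that consists of
   the matrices with rows t_l (sgF2 (a_i g_l))_i, where sum_l t_l = 1. *)
Definition free_mx : set W :=
  [set M : W | `|M| <= 1 /\ exists l, forall i, n.+1%:R^-1 <= `|M l i|].

Lemma free_mx_act g M : free_mx M -> free_mx (sgmx g M).
Proof.
case=> M1 [l Ml]; split; first by rewrite norm_sgmx.
by exists l => i; rewrite sgmxE normrM sgF2_norm mul1r.
Qed.

(** A sign that fixes a nonzero entry is 1, and the row [l] has no zero entry. *)
Lemma free_mx_free g M : free_mx M -> sgmx g M = M -> forall i, a i g = 0.
Proof.
move=> [_ [l Ml]] /matrixP gM i; apply: (@sgF2_eq1 R).
have /negPf Mli : M l i != 0.
  by rewrite -normr_gt0; apply: lt_le_trans (Ml i); rewrite invr_gt0 ltr0n.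
have := gM l i; rewrite sgmxE => /eqP.
by rewrite -subr_eq0 -{2}[M l i]mul1r -mulrBl mulf_eq0 Mli orbF subr_eq0 => /eqP.
Qed.

Lemma entry_continuous l i : continuous (fun M : W => M l i).
Proof.
move=> M; apply: (@cvgrPdist_lt _ _ _ _ (nbhs_filter M) _ _).2 => e e0.
apply: filterS (near_dist_lt M e0) => M'; apply: le_lt_trans.
by have := mx_entry_le (M - M') l i; rewrite !mxE.
Qed.

Lemma vec_mx_continuous : continuous (vec_mx : 'rV[R]_(n.+1 * r) -> W).
Proof.
move=> v; apply: (@cvgrPdist_lt _ _ _ _ (nbhs_filter v) _ _).2 => e e0.
apply: filterS (near_dist_lt v e0) => v'; apply: le_lt_trans.
rewrite -linearB; apply: mx_norm_le => // l i; rewrite !mxE.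
rewrite [leRHS]/Num.norm /= mx_normrE.
by apply/bigmax_geP; right => /=; exists (ord0, mxvec_index l i); rewrite ?mxE.
Qed.

(** A closed subset of the cube of matrices with entries in [-1, 1], itself the image of a product
    of segments. The choice of the row [l] amounts to a finite union. *)
Lemma free_mx_compact : compact free_mx.
Proof.
have cv : compact
    [set v : 'rV[R]_(n.+1 * r) | forall j, v ord0 j \in `[(-1 : R), 1]].
  apply: (@rV_compact R _ (fun=> `[(-1 : R), 1]%classic)).
  by move=> _; apply: segment_compact.
have cB : compact [set M : W | forall l i, `|M l i| <= 1].
  rewrite (_ : mkset _ =
    vec_mx @` [set v : 'rV[R]_(n.+1 * r) | forall j, v ord0 j \in `[(-1 : R), 1]]).
    apply: (continuous_compact _ cv).
    by apply: continuous_subspaceT; exact: vec_mx_continuous.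
  apply/seteqP; split => [M HM|_ [v Hv <-] l i].
    exists (mxvec M); last exact: mxvecK.
    move=> j; case/mxvec_indexP: j => l i.
    by rewrite mxvecE in_itv /= -ler_norml.
  by rewrite mxE; have := Hv (mxvec_index l i); rewrite in_itv /= -ler_norml.
apply: (subclosed_compact _ cB); last first.
  by move=> M [M1 _] l i; apply: le_trans M1; exact: mx_entry_le.
have -> : free_mx = [set M : W | `|M| <= 1] `&`
    \bigcup_(l in [set: 'I_n.+1]) \bigcap_(i in [set: 'I_r])
      [set M : W | n.+1%:R^-1 <= `|M l i|].
  apply/seteqP; split => [M [M1 [l Ml]]|M [M1 [l _ Ml]]].
    by split => //; exists l => // i _; exact: Ml.
  by split => //; exists l => i; exact: Ml.
apply: closedI.
  apply: (closed_comp (f := fun M : W => `|M|) (D := [set x | x <= 1])).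
    by move=> M _; exact: norm_continuous.
  exact: closed_le.
apply: closed_bigcup => [|l _]; first exact: finite_finset.
apply: closed_bigI => i _.
apply: (closed_comp (f := fun M : W => `|M l i|) (D := [set x | n.+1%:R^-1 <= x])).
  move=> M _; apply: (@continuous_comp _ _ _ (fun M : W => M l i) Num.norm).
    exact: entry_continuous.
  exact: norm_continuous.
exact: closed_ge.
Qed.
End SignAction.

(** * The simplices of the join as sets of matrices *)

Section JoinSimplices.
Variables (R : realType) (E : Type) (r : nat) (a : 'I_r -> E -> 'F_2).
Variable n : nat.
Local Notation W := 'M[R]_(n.+1, r).
Implicit Types (e : nat -> 'I_r -> 'F_2) (M : W) (sigma : seq W).

Definition vertex e (k : nat) : W :=
  \matrix_(l, i) if l == k :> nat then sgF2 R (e k i) else 0.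

(** For r > 0, the simplex spanned by the [vertex e k] with k <= n: the barycentric coordinate of
    the vertex l is the common value of [sgF2 R (e l i) * M l i] over i. The signs [e] need not come
    from group elements. *)
Definition join_face e : set W := [set M : W |
  [/\ forall (l : 'I_n.+1) i, 0 <= sgF2 R (e l i) * M l i,
      forall (l : 'I_n.+1) i j, sgF2 R (e l i) * M l i = sgF2 R (e l j) * M l j &
      forall i, \sum_(l < n.+1) sgF2 R (e l i) * M l i = 1]].

Lemma baryE sigma l i :
  bary sigma l i = (size sigma)%:R^-1 * \sum_(M <- sigma) M l i.
Proof. by rewrite mxE summxE. Qed.

Lemma join_face_bary e : bary_closed (join_face e).
Proof.
move=> sigma s0 H; split=> [l i|l i j|i].
- rewrite baryE mulrCA mulr_ge0 ?invr_ge0 ?ler0n // mulr_sumr big_seq.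
  by apply: sumr_ge0 => M /H[].
- rewrite !baryE ![sgF2 R _ * _]mulrCA; congr (_ * _).
  by rewrite !mulr_sumr !big_seq; apply: eq_bigr => M /H[].
under eq_bigr do rewrite baryE mulrCA mulr_sumr.
rewrite -mulr_sumr exchange_big big_seq (eq_bigr (fun=> 1)) /=; last first.
  by move=> M /H[].
rewrite -big_seq big_const_seq count_predT iter_addr_0 mulVf //.
by rewrite pnatr_eq0 -lt0n.
Qed.

(** The n + 1 barycentric coordinates are nonnegative with sum 1, so one of them is at least 1/(n +
    1). *)
Lemma join_face_sub e : join_face e `<=` @free_mx R r n.
Proof.
move=> M [M0 Mij M1].
have normM (l : 'I_n.+1) i : `|M l i| = sgF2 R (e l i) * M l i.
  by rewrite -(ger0_norm (M0 l i)) normrM sgF2_norm mul1r.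
split.
  apply: mx_norm_le => // l i; rewrite normM -(M1 i) (bigD1 l) //= lerDl.
  exact: sumr_ge0.
have [i0|r0] := pselect (exists i : 'I_r, True); last first.
  by exists ord0 => i; case: r0; exists i.
case: i0 => i _.
have [l Ml] : exists l, n.+1%:R^-1 <= `|M l i|.
  apply: contrapT => /forallNP H.
  suff : \sum_(l < n.+1) sgF2 R (e l i) * M l i < \sum_(l < n.+1) n.+1%:R^-1.
    by rewrite M1 sumr_const card_ord -[X in _ < X]mulr_natl mulfV ?ltxx ?pnatr_eq0.
  apply: ltr_sum => [|l _].
    by apply/hasP; exists ord0; rewrite ?mem_index_enum.
  by rewrite -normM ltNge; apply/negP/H.
by exists l => j; rewrite normM (Mij _ _ i) -normM.
Qed.

Lemma vertex_face e k : (k <= n)%N -> join_face e (vertex e k).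
Proof.
move=> kn.
have vE (l : 'I_n.+1) i : sgF2 R (e l i) * vertex e k l i = (l == k :> nat)%:R.
  rewrite mxE; case: eqP => [->|_]; last by rewrite mulr0.
  by rewrite sgF2_sqr.
split=> [l i|l i j|i]; rewrite ?vE //.
under eq_bigr do rewrite vE.
rewrite (bigD1 (inord k)) //= inordK // eqxx big1 ?addr0 // => l lk.
rewrite (_ : (_ == _) = false) //; apply: contraNF lk => /eqP <-.
by rewrite inord_val.
Qed.

(** A group element changes the signs of all rows by the same pattern, and the new apex lies in a
    row of its own; so one [e] serves all vertices, which thus lie in one [join_face]. *)
Lemma join_simplex_vertices (gs : nat -> E) k sigma : (k <= n)%N ->
  join_simplex (vertex (fun _ _ => 0)) (fun i => sgmx R a n (gs i)) k sigma ->
  exists e, forall M, M \in sigma -> exists2 l, (l <= k)%N & M = vertex e l.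
Proof.
elim: k sigma => [|k IH] sigma kn /=.
  move=> ->; exists (fun _ _ => 0) => M; rewrite inE => /eqP->.
  by exists 0%N.
case=> tau /(IH _ (ltnW kn))[e He] Hs.
have [g sgE] : exists g : 'I_r -> 'F_2, forall M, M \in sigma ->
    M = vertex (fun _ _ => 0) k.+1 \/ exists2 l, (l <= k)%N &
    M = vertex (fun l i => e l i + g i) l.
  case: Hs => [->|[i ->]].
    exists (fun=> 0) => M; rewrite inE => /orP[/eqP->|/He[l lk ->]]; [by left|right].
    by exists l => //; apply/matrixP => l' i; rewrite !mxE addr0.
  exists (fun j => a j (gs i)) => M.
  rewrite inE => /orP[/eqP->|/mapP[M' /He[l lk ->] ->]]; [by left|right].
  exists l => //; apply/matrixP => l' j; rewrite sgmxE !mxE.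
  by case: eqP; rewrite ?mulr0 // sgF2D mulrC.
exists (fun l i => if l == k.+1 then 0 else e l i + g i) => M /sgE[->|[l lk ->]].
  by exists k.+1 => //; apply/matrixP => l i; rewrite !mxE eqxx.
exists l; first exact: leqW.
by apply/matrixP => l' i; rewrite !mxE (ltn_eqF (lk : (l < k.+1)%N)).
Qed.

Lemma free_mx_not_locally_constant (s : nat -> W -> 'F_2) (b : nat -> E -> 'F_2) :
  (forall j g M, free_mx M -> s j (sgmx R a n g M) = s j M + b j g) ->
  (forall j, exists g, b j g != 0) ->
  ~ (forall M, free_mx M -> exists2 j, (j < n)%N &
       \forall M' \near M, free_mx M' -> s j M' = s j M).
Proof.
move=> sE /choice[gs Hgs] sloc.
(* Only the n + 1 elements [gs 0], ..., [gs n] enter the chains. Truncating the index at n makes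
   each [b j] nonzero at one of them. *)
apply: (@not_locally_constant R W n.+1 (vertex (fun _ _ => 0))
  (fun i => sgmx R a n (gs i)) _ _ (@free_mx R r n) n _
  (fun j => s (minn j n)) (fun j i => b (minn j n) (gs i))).
- by move=> i; exact: sgmxK.
- by move=> i j x; exact: sgmxC.
- move=> k sigma kn /(join_simplex_vertices kn)[e He].
  exists (join_face e); first exact: join_face_bary.
  split; first exact: join_face_sub.
  by move=> M /He[l lk ->]; apply: vertex_face; exact: leq_trans kn.
- exact: free_mx_compact.
- by exists 1 => M [].
- by move=> j i M XM; exact: sE.
- by move=> j; exists (minn j n); [rewrite ltnS geq_minr|exact: Hgs].
move=> M /sloc[j jn Hj]; exists j => //.
by rewrite (minn_idPl (ltnW jn)).
Qed.
End JoinSimplices.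

(** * Sign functions from covers of bounded order *)

Section Sign.
Variables (R : realType) (W : topologicalType).

Definition sign_of (t : R) : 'F_2 := if t < 0 then 1 else 0.

Lemma sign_ofM (c : 'F_2) t : t != 0 -> sign_of (sgF2 R c * t) = sign_of t + c.
Proof.
have [->|/F2_eq1->] := eqVneq c 0; first by rewrite sgF20 mul1r addr0.
rewrite /sgF2 expr1 mulN1r /sign_of oppr_lt0.
by case: ltgtP => // _ _; rewrite ?addF2 ?add0r.
Qed.

Lemma lt_near (t u : W -> R) (x : W) : continuous t -> continuous u ->
  t x < u x -> \forall y \near x, t y < u y.
Proof.
move=> ct cu tu.
have : (fun y => u y - t y) @ x --> u x - t x by apply: cvgB; [exact: cu|exact: ct].
move=> /cvgr_gt /(_ 0); rewrite subr_gt0 => /(_ tu).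
by apply: filterS => y; rewrite subr_gt0.
Qed.

Lemma sign_of_near (t : W -> R) (x : W) : continuous t -> t x != 0 ->
  \forall y \near x, t y != 0 /\ sign_of (t y) = sign_of (t x).
Proof.
move=> ct tx; have c0 : continuous (fun _ : W => 0 : R) by move=> ?; exact: cvg_cst.
have [neg|pos] : t x < 0 \/ 0 < t x.
  by move: tx; case: ltgtP => //; [left|right].
  have := lt_near ct c0 neg; apply: filterS => y yneg.
  by rewrite /sign_of yneg neg lt_eqF.
have := lt_near c0 ct pos; apply: filterS => y ypos.
by rewrite /sign_of ltNge (ltW ypos) ltNge (ltW pos) gt_eqF.
Qed.
End Sign.

(** * Colourings by dominant sets of functions *)

Section SignColouring.
Variables (R : realType) (W : normedModType R) (E : Type) (act : E -> W -> W).
Variables (X : set W) (alpha : E -> 'F_2) (s0 : W -> 'F_2).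
Hypothesis s0_act : forall g x, X x -> s0 (act g x) = s0 x + alpha g.
Variables (p : nat) (r : 'I_p -> W -> R).
Hypothesis r_act : forall i g x, X x -> r i (act g x) = sgF2 R (alpha g) * r i x.
Hypothesis r_cont : forall i, continuous (r i).
Implicit Types (x y : W) (A B : {set 'I_p}) (i j : 'I_p).

Definition dominant A x := [forall i in A, (r i x != 0) &&
  [forall j, (j \notin A) ==> (`|r j x| < `|r i x|)]].

Lemma dominantP A x : reflect (forall i, i \in A -> r i x != 0 /\
  forall j, j \notin A -> `|r j x| < `|r i x|) (dominant A x).
Proof.
apply: (iffP forall_inP) => H i iA.
  by have /andP[-> /forallP H'] := H i iA; split => // j jA; apply: implyP jA.
have [-> H'] := H i iA; apply/forallP => j; apply/implyP; exact: H'.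
Qed.

(** Distinct sets of equal size have i in A outside B and j in B outside A, and then |r_j| < |r_i| <
    |r_j| at x. *)
Lemma dominant_inj A B x : dominant A x -> dominant B x -> #|A| = #|B| -> A = B.
Proof.
move=> /dominantP HA /dominantP HB AB; apply/eqP; rewrite eqEcard AB leqnn andbT.
apply: contraT => /subsetPn[i iA iB].
have /subsetPn[j jB jA] : ~~ (B \subset A).
  apply: contra iB => BA; have /eqP-> // : B == A.
  by rewrite eqEcard BA AB leqnn.
have [_ /(_ j jA) l1] := HA i iA; have [_ /(_ i iB) l2] := HB j jB.
by have := lt_trans l1 l2; rewrite ltxx.
Qed.

Lemma dominant_act A g x : X x -> dominant A (act g x) = dominant A x.
Proof.
move=> Xx; have rn i : `|r i (act g x)| = `|r i x|.
  by rewrite r_act // normrM sgF2_norm mul1r.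
have rn0 i : (r i (act g x) != 0) = (r i x != 0) by rewrite -normr_gt0 rn normr_gt0.
by apply/dominantP/dominantP => H i /H[]; rewrite rn0 => ri0 H'; split=> // j /H';
  rewrite !rn.
Qed.

(* By dominant_inj at most one A of a given size is dominant at x, and it stays
   dominant near x; this reduces the r i to as many functions as there are r i
   nonzero at a point. *)
Definition colour k x : 'F_2 :=
  if [pick A : {set 'I_p} | (#|A| == k.+1) && dominant A x] is Some A then
    if [pick i in A] is Some i then sign_of (r i x) else s0 x
  else s0 x.

(** Dominance is invariant, so the same [A] and the same index in it are picked at both points. *)
Lemma colour_act k g x : X x -> colour k (act g x) = colour k x + alpha g.
Proof.
move=> Xx; rewrite /colour; under eq_pick do rewrite dominant_act //.
case: pickP => [A /andP[_ /dominantP HA]|_]; last exact: s0_act.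
case: pickP => [i iA|_]; last exact: s0_act.
by rewrite r_act // sign_ofM //; have [] := HA i iA.
Qed.

(** The set [A] of indices where |r_i x| is maximal is dominant, has at most [L] elements, and near
    [x] stays dominant while its functions keep their signs. Hence k = |A| - 1 works. *)
Lemma colour_near L x : (exists i, r i x != 0) ->
  (#|[set i | r i x != 0%R]%SET| <= L)%N ->
  exists2 k, (k < L)%N & \forall y \near x, colour k y = colour k x.
Proof.
case=> i0 ri0 HL.
pose im := [arg max_(i > i0) `|r i x|]%O.
have max_im j : `|r j x| <= `|r im x|.
  by rewrite /im; case: arg_maxP => // i _; exact.
have rim : r im x != 0.
  by rewrite -normr_gt0; apply: lt_le_trans (max_im i0); rewrite normr_gt0.
pose A : {set 'I_p} := [set i | `|r i x| == `|r im x|]%SET.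
have A_gt0 : (0 < #|A|)%N by apply/card_gt0P; exists im; rewrite inE eqxx.
have HA : dominant A x.
  apply/dominantP => i; rewrite inE => /eqP ri; split.
    by rewrite -normr_gt0 ri normr_gt0.
  by move=> j; rewrite inE ri => rj; rewrite lt_neqAle rj max_im.
exists #|A|.-1; first rewrite prednK //.
  apply: leq_trans HL; apply: subset_leq_card; apply/fintype.subsetP => i; rewrite !inE => /eqP ri.
  by rewrite -normr_gt0 ri normr_gt0.
have colourE y : dominant A y -> colour #|A|.-1 y =
    if [pick i in A] is Some i then sign_of (r i y) else s0 y.
  move=> Ay; rewrite /colour prednK //.
  case: pickP => [B /andP[/eqP AB By]|/(_ A)]; last by rewrite eqxx Ay.
  by rewrite (dominant_inj By Ay AB).
have near1 : \forall y \near x, dominant A y.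
  have : \forall y \near x, forall i, i \in A -> r i y != 0 /\
      forall j, j \notin A -> `|r j y| < `|r i y|.
    apply: filter_forall => i; have [iA|iA] := boolP (i \in A); last first.
      by apply: nearW => y.
    have [ri rij] := elimT (dominantP _ _) HA i iA.
    have cn j : continuous (fun y => `|r j y|).
      by move=> y; apply: cvg_norm; exact: r_cont.
    have : \forall y \near x, forall j, j \notin A -> `|r j y| < `|r i y|.
      apply: filter_forall => j; have [jA|jA] := boolP (j \in A); first by apply: nearW.
      by apply: filterS (lt_near (cn j) (cn i) (rij j jA)) => y.
    by apply: filterS2 (sign_of_near (@r_cont i) ri) => y [].
  by apply: filterS => y; exact: introT (dominantP _ _).
have near2 : \forall y \near x, forall i, i \in A -> sign_of (r i y) = sign_of (r i x).
  apply: filter_forall => i; have [iA|iA] := boolP (i \in A); last first.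
    by apply: nearW.
  have [ri _] := elimT (dominantP _ _) HA i iA.
  by apply: filterS (sign_of_near (@r_cont i) ri) => y [].
apply: filterS2 near1 near2 => y Ay Hy; rewrite !colourE //.
case: pickP => [i /Hy//|A0].
by move: A_gt0; rewrite (eq_card0 A0).
Qed.
End SignColouring.

Lemma sgF2_inj (R : realType) : injective (@sgF2 R).
Proof.
move=> x y xy; apply/eqP; rewrite -subr_eq0; apply/eqP/(@sgF2_eq1 R).
have -> : x - y = x + y by congr (x + _); apply/esym/eqP; rewrite -addr_eq0 addF2.
by rewrite sgF2D xy sgF2_sqr.
Qed.

Lemma addEE (E : lmodType 'F_2) (g : E) : g + g = 0.
Proof. by rewrite -[g]scale1r -scalerDl addF2 scale0r. Qed.

(** * Eigenvectors of Euclidean modules *)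

Section Eigenvectors.
Variables (R : realType) (E : lmodType 'F_2) (U : euclideanModule R E).
Implicit Types (u v : U) (g h : E).

Lemma act_comp g h u : act g (act h u) = act (g + h) u.
Proof. by rewrite /act emod_actD comp_lfunE. Qed.

Lemma act0 u : act 0 u = u.
Proof. by rewrite /act emod_act0 id_lfunE. Qed.

Lemma actK g : involutive (@act R E U g).
Proof. by move=> u; rewrite act_comp addEE act0. Qed.

Lemma actD g u v : act g (u + v) = act g u + act g v.
Proof. exact: linearD. Qed.

Lemma actZ g (c : R) u : act g (c *: u) = c *: act g u.
Proof. exact: linearZ. Qed.

Lemma inner_act g u v : inner (act g u) (act g v) = inner u v.
Proof. exact: emod_inner_act. Qed.

Lemma inner_actl g u v : inner (act g u) v = inner u (act g v).
Proof. by rewrite -[in LHS](actK g v) inner_act. Qed.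

Lemma inner_suml (I : Type) (s : seq I) (F : I -> U) v :
  inner (\sum_(i <- s) F i) v = \sum_(i <- s) inner (F i) v.
Proof.
by rewrite (big_morph (fun x : U => inner x v) (fun x y => innerDl x y v) (inner0l v)).
Qed.

Definition orthogonal_seq (P : U -> Prop) (s : seq U) :=
  (forall v, v \in s -> P v /\ v != 0) /\ pairwise (fun u v => inner u v == 0) s.

Lemma orthogonal_nth P s i j : orthogonal_seq P s ->
  (i < size s)%N -> (j < size s)%N -> i != j -> inner s`_i s`_j = 0.
Proof.
move=> [_ /(pairwiseP 0) H] si sj; case: (ltngtP i j) => // ij _.
  by apply/eqP/H.
by rewrite innerC; apply/eqP/H.
Qed.

Lemma orthogonal_size P s : orthogonal_seq P s -> (size s <= \dim {:U})%N.
Proof.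
move=> os; have : free (in_tuple s).
  apply/freeP => c /= c0 j.
  have /eqP := congr1 (fun x : U => inner x s`_j) c0.
  rewrite inner0l inner_suml (bigD1 j) //= big1 ?addr0; last first.
    move=> i ij; rewrite innerZl (orthogonal_nth os) ?mulr0 //.
  have [_ sj0] := os.1 _ (mem_nth 0 (ltn_ord j)).
  by rewrite innerZl mulf_eq0 (gt_eqF (inner_gt0 sj0)) orbF => /eqP.
by rewrite /free => /eqP <-; apply: dimvS; exact: subvf.
Qed.

(** Orthogonal families of nonzero vectors have bounded length, so one of them cannot be
    extended. *)
Lemma ex_max_orthogonal (P : U -> Prop) : exists r (v : 'I_r -> U),
  [/\ forall i, P (v i) /\ v i != 0,
      forall i j, i != j -> inner (v i) (v j) = 0 &
      forall u, P u -> u != 0 -> exists i, inner u (v i) != 0].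
Proof.
have [s os smax] : exists2 s, orthogonal_seq P s &
    forall u, P u -> u != 0 -> exists2 v, v \in s & inner u v != 0.
  apply: contrapT => /forall2NP nomax.
  suff /(_ (\dim {:U}).+1)[s /orthogonal_size le_s sE] :
      forall k, exists2 s, orthogonal_seq P s & size s = k.
    by move: le_s; rewrite sE ltnn.
  elim=> [|k [s os <-]]; first by exists [::].
  case: (nomax s) => // /existsNP[u /not_implyP[Pu /not_implyP[u0 us]]].
  exists (u :: s) => //; split.
    by move=> v; rewrite inE => /orP[/eqP->//|/os.1].
  rewrite /= os.2 andbT; apply/allP => v vs; apply: contrapT => uv.
  by apply: us; exists v => //; exact/negP.
exists (size s), (fun i => s`_i); split.
- by move=> i; apply: os.1; exact: mem_nth.
- by move=> i j ij; apply: (orthogonal_nth os).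
move=> u Pu /(smax u Pu)[v /(nthP 0)[i si <-] uv].
by exists (Ordinal si).
Qed.

(** [beta] is any function; it is additive as soon as [u] is nonzero. *)
Definition eigenvector (beta : E -> 'F_2) u :=
  forall g, act g u = sgF2 R (beta g) *: u.

Lemma eigenvectorD beta u : eigenvector beta u -> u != 0 ->
  forall g h, beta (g + h) = beta g + beta h.
Proof.
move=> ub u0 g h; apply: (@sgF2_inj R).
have /eqP : sgF2 R (beta (g + h)) *: u = sgF2 R (beta g + beta h) *: u.
  by rewrite -ub sgF2D mulrC -scalerA -ub -actZ -ub act_comp.
by rewrite -subr_eq0 -scalerBl scaler_eq0 (negPf u0) orbF subr_eq0 => /eqP.
Qed.

(** In a maximal orthogonal family of eigenvectors, suppose all a_i(g) = 0 but alpha(g) = 1 with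
    U^alpha nonzero. Then [g] acts by -1 on U^alpha and by 1 on every v_i, so U^alpha is orthogonal
    to the family, against maximality. *)
Lemma ex_faithful_eigenvectors :
  \bigcap_(alpha in [set alpha : {scalar E} | eigenset U alpha <> [set 0]])
    [set g : E | alpha g = 0] = [set 0] ->
  exists r (v : 'I_r -> U) (a : 'I_r -> E -> 'F_2),
  [/\ forall i, eigenvector (a i) (v i) /\ v i != 0,
      forall i j, i != j -> inner (v i) (v j) = 0 &
      forall g, (forall i, a i g = 0) -> g = 0].
Proof.
move=> /seteqP[hker _].
have [r [v [Pv ov vmax]]] := ex_max_orthogonal
  (fun u => exists alpha : {scalar E}, eigenset U alpha u).
have /choice[a Ha] : forall i, exists alpha : {scalar E}, eigenset U alpha (v i).
  by move=> i; have [] := Pv i.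
exists r, v, (fun i => a i); split => //.
  by move=> i; split; [exact: Ha|have [] := Pv i].
move=> g ag; apply: hker => alpha /= Ualpha.
apply: contrapT => /eqP /F2_eq1 alphag; apply: Ualpha.
apply/seteqP; split => [u Hu|_ ->]; last first.
  by move=> h; rewrite /act linear0 scaler0.
apply: contrapT => /eqP u0.
have [|i] := vmax u _ u0; first by exists alpha.
rewrite -(inner_act g) Hu (Ha i) ag alphag expr0 scale1r scaleN1r.
have -> : inner (- u) (v i) = - inner u (v i) by rewrite -scaleN1r innerZl mulN1r.
have := inner_act g u (v i); rewrite Hu (Ha i) ag alphag expr0 scale1r expr1.
rewrite innerZl mulN1r => uv; rewrite oppr_eq0 => /eqP; apply.
by move: uv; lra.
Qed.

(** Simultaneous diagonalisation for finite [E]: a nonzero vector orthogonal to a maximal family of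
    eigenvectors would yield a further eigenvector orthogonal to it. No character is trivial since
    no nonzero vector is fixed. *)
Lemma ex_complete_eigenvectors (es : seq E) : (forall g, g \in es) ->
  fixed_points U = [set 0] ->
  exists r (v : 'I_r -> U) (b : 'I_r -> E -> 'F_2),
  [/\ forall i, eigenvector (b i) (v i) /\ v i != 0,
      forall i, exists g, b i g != 0 &
      forall u, (forall i, inner u (v i) = 0) -> u = 0].
Proof.
move=> Hes /seteqP[fixU _].
have [r [v [Pv _ vmax]]] := ex_max_orthogonal
  (fun u => exists beta, eigenvector beta u).
have /choice[b Hb] : forall i, exists beta, eigenvector beta (v i).
  by move=> i; have [] := Pv i.
exists r, v, b; split => [i|i|u uv].
- by split; [exact: Hb|have [] := Pv i].
- apply: contrapT => /forallNP bi0; have [_ /eqP] := Pv i; apply.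
  apply: fixU => g; rewrite Hb; have /negP := bi0 g.
  by rewrite negbK => /eqP->; rewrite sgF20 scale1r.
apply: contrapT => /eqP u0.
suff [w [w0 wv ws]] : exists w, [/\ w != 0, forall i, inner w (v i) = 0 &
    forall g, g \in es -> act g w = w \/ act g w = - w].
  have [|i] := vmax w _ w0; last by rewrite wv eqxx.
  exists (fun g => if act g w == w then 0 else 1) => g.
  case: eqP => [->|gw]; first by rewrite sgF20 scale1r.
  by have [//|->] := ws g (Hes g); rewrite /sgF2 expr1 scaleN1r.
(* Unless h w = - w, replace w by w + h w, which is nonzero and fixed by h; as [E] is commutative,
   the earlier elements keep their signs. *)
elim: es {Hes} => [|h es [w [w0 wv ws]]]; first by exists u.
have [hw|hw] := eqVneq (act h w) (- w).
  by exists w; split=> // g; rewrite inE => /orP[/eqP->|/ws//]; right.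
exists (w + act h w); split.
- by rewrite addrC addr_eq0.
- by move=> i; rewrite innerDl inner_actl Hb innerZr !wv mulr0 addr0.
move=> g; rewrite inE => /orP[/eqP->|/ws gw].
  by left; rewrite actD actK addrC.
have -> : act g (w + act h w) = act g w + act h (act g w).
  by rewrite actD !act_comp [g + h]addrC.
case: gw => ->; [by left|right].
by rewrite -scaleN1r actZ -scalerDr scaleN1r.
Qed.
End Eigenvectors.

(** * Embedding matrices in the mapping space *)

Section PolynomialMaps.
Variables (R : realType) (E : lmodType 'F_2) (U : euclideanModule R E).
Variables (r : nat) (v : 'I_r -> U) (a : 'I_r -> E -> 'F_2) (n : nat).
Hypothesis va : forall i, eigenvector (a i) (v i).
Hypothesis v0 : forall i, v i != 0.
Hypothesis ov : forall i j, i != j -> inner (v i) (v j) = 0.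
Local Notation W := 'M[R]_(n.+1, r).
Implicit Types (M : W) (l : 'I_n.+1) (i : 'I_r) (y : sphere U).

Lemma inner_norm_le (u w : U) : `|inner u w| <= `|u| * `|w|.
Proof.
rewrite -sqrtr_sqr -[_ * _]/(enorm u * enorm w) /enorm -sqrtrM ?inner_ge0//.
by rewrite ler_wsqrtr// inner_cauchy_schwarz.
Qed.

Lemma inner_continuous (w : U) : continuous (fun u : U => inner u w).
Proof.
move=> u; apply: (@cvgrPdist_lt _ _ _ _ (nbhs_filter u) _ _).2 => e e0.
have w1 : 0 < `|w| + 1 by rewrite ltr_wpDl.
have := near_dist_lt u (divr_gt0 e0 w1); apply: filterS => u' uu'.
have -> : inner u w - inner u' w = inner (u - u') w.
  by rewrite innerDl -[in RHS]scaleN1r innerZl mulN1r.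
apply: le_lt_trans (inner_norm_le _ _) _.
rewrite ltr_pdivlMr // in uu'; apply: le_lt_trans uu'.
by apply: ler_wpM2l => //; rewrite lerDl.
Qed.

Definition height l : R := l%:R / n.+1%:R.

Lemma height_inj : injective height.
Proof.
move=> l l' /(mulIf _); rewrite invr_neq0 ?pnatr_eq0 // => /(_ isT)/eqP.
by rewrite eqr_nat => /eqP/val_inj.
Qed.

Lemma height_lt1 l : height l ^+ 2 < 1.
Proof.
have h0 : 0 <= height l by rewrite divr_ge0.
by rewrite expr_lt1 // /height ltr_pdivrMr ?ltr0n // mul1r ltr_nat.
Qed.

(** Not normalised: only being zero or nonzero at the heights matters. *)
Definition lagrange l : {poly R} :=
  \prod_(k < n.+1 | k != l) ('X - (height k)%:P).

Lemma lagrangeE l l' : ((lagrange l).[height l'] != 0) = (l == l').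
Proof.
rewrite /lagrange horner_prod; have [<-|ll'] := eqVneq l l'.
  apply/prodf_neq0 => k kl; rewrite hornerXsubC subr_eq0.
  by apply: contra kl => /eqP/height_inj->.
rewrite (bigD1 l') 1?eq_sym //= hornerXsubC subrr mul0r eqxx //.
Qed.

Definition poly_fun M y : R := \sum_l \sum_i
  M l i * ((lagrange l).[(\val y).1] * inner (\val y).2 (v i)).

Lemma poly_fun_continuous :
  continuous (fun My : W * sphere U => poly_fun My.1 My.2).
Proof.
have val_cont : continuous (set_val : sphere U -> R * U) by exact: initial_continuous.
apply: continuous_big => [|l _]; first exact: add_continuous.
apply: continuous_big => [|i _ [M y]]; first exact: add_continuous.
have cM : {for (M, y), continuous (fun My : W * sphere U => My.1 l i)}.
  apply: (@continuous_comp _ _ _ fst (fun M : W => M l i)); first exact: cvg_fst.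
  exact: entry_continuous.
have cy : {for (M, y), continuous (fun My : W * sphere U => set_val My.2)}.
  apply: (@continuous_comp _ _ _ snd (set_val : sphere U -> R * U)); first exact: cvg_snd.
  exact: val_cont.
have ct : {for (M, y), continuous (fun My : W * sphere U =>
    (lagrange l).[(set_val My.2).1])}.
  apply: (@continuous_comp _ _ _ (fun My : W * sphere U => (set_val My.2).1)
    (horner (lagrange l))); last exact: continuous_horner.
  by apply: (cvg_comp _ _ cy); exact: cvg_fst.
have cu : {for (M, y), continuous (fun My : W * sphere U =>
    inner (set_val My.2).2 (v i))}.
  apply: (@continuous_comp _ _ _ (fun My : W * sphere U => (set_val My.2).2)
    (fun u : U => inner u (v i))); last exact: inner_continuous.
  by apply: (cvg_comp _ _ cy); exact: cvg_snd.
exact: (cvgM cM (cvgM ct cu)).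
Qed.

Lemma poly_fun_pointed M : (poly_fun M : {compact-open, sphere U -> R}) \in
  @pointed_map_set R E U.
Proof.
apply/mem_set; split.
  by have [_] := continuous_curry poly_fun_continuous; apply.
by rewrite /poly_fun big1 // => l _; rewrite big1 // => i _; rewrite inner0l !mulr0.
Qed.

Definition poly_map M : pointed_map U := exist _ (poly_fun M) (poly_fun_pointed M).

Lemma poly_map_continuous : continuous poly_map.
Proof.
apply: (@continuous_comp_initial _ W {compact-open, sphere U -> R} set_val).
exact: continuous_curry_fun poly_fun_continuous.
Qed.

(** Moving [g] across the inner product multiplies <u, v_i> by the sign of a_i(g), which [sgmx] puts
    into the column i. *)
Lemma poly_map_act g M : pointed_map_act g (poly_map M) = poly_map (sgmx R a n g M).
Proof.
apply: val_inj; apply: funext => y /=.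
apply: eq_bigr => l _; apply: eq_bigr => i _.
have gE : - g = g by apply/esym/eqP; rewrite -addr_eq0 addEE.
rewrite sgmxE /= inner_actl gE va innerZr.
by rewrite mulrCA [sgF2 _ _ * inner _ _]mulrC; ring.
Qed.

(** The factor that puts the multiple of [v i] at height [l] on the sphere. *)
Definition radius l i : R := Num.sqrt (1 - height l ^+ 2) / `|v i|.

Lemma radius_gt0 l i : 0 < radius l i.
Proof. by rewrite divr_gt0 ?normr_gt0 // sqrtr_gt0 subr_gt0 height_lt1. Qed.

Lemma node_subproof l i :
  ((height l, radius l i *: v i) : R * U) \in @sphere_set R E U.
Proof.
rewrite inE /sphere_set /= normrZ gtr0_norm ?radius_gt0 //.
rewrite /radius divfK ?normr_eq0 // sqr_sqrtr ?subr_ge0 ?ltW ?height_lt1 //.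
by rewrite addrC subrK.
Qed.

Definition node l i : sphere U := exist _ (height l, radius l i *: v i) (node_subproof l i).

Definition node_coef l i : R :=
  (lagrange l).[height l] * (radius l i * inner (v i) (v i)).

Lemma node_coef_neq0 l i : node_coef l i != 0.
Proof.
apply: mulf_neq0; first by rewrite lagrangeE.
by apply: mulf_neq0; rewrite gt_eqF // ?radius_gt0 // inner_gt0.
Qed.

(** The Lagrange factors kill the other rows and orthogonality the other columns. Hence evaluation
    at the nodes recovers the matrix. *)
Lemma poly_map_node M l i : \val (poly_map M) (node l i) = M l i * node_coef l i.
Proof.
rewrite /= /poly_fun (bigD1 l) //= (bigD1 i) //= innerZl.
rewrite big1 ?addr0 => [|j ji]; last first.
  by rewrite innerZl ov ?mulr0 // eq_sym.
rewrite big1 ?addr0 // => k kl; rewrite big1 // => j _.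
have := lagrangeE k l; rewrite (negPf kl) => /negbFE/eqP->.
by rewrite mul0r mulr0.
Qed.
End PolynomialMaps.

(** The [a i] embed [E] in F_2^r; one element is chosen for each vector of values that occurs. *)
Lemma ex_enum (E : lmodType 'F_2) r (a : 'I_r -> E -> 'F_2) :
  (forall i g h, a i (g + h) = a i g + a i h) ->
  (forall g, (forall i, a i g = 0) -> g = 0) ->
  exists2 es : seq E, uniq es & forall g, g \in es.
Proof.
move=> aD a_inj.
pose A (c : {ffun 'I_r -> 'F_2}) := [set g | forall i, a i g = c i].
exists (undup [seq xget 0 (A c) | c : {ffun 'I_r -> 'F_2}]).
  exact: undup_uniq.
move=> g; rewrite mem_undup; apply/mapP.
exists [ffun i => a i g]; first by rewrite mem_enum.
case: xgetP => [h _ Ah|/(_ g)]; last by case=> i; rewrite ffunE.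
apply/eqP; rewrite -subr_eq0; apply/eqP/a_inj => i.
have := Ah i; rewrite ffunE => ah.
have -> : - h = h by apply/esym/eqP; rewrite -addr_eq0 addEE.
by rewrite aD ah addF2.
Qed.

(* The map e is discontinuous in general. *)
Lemma ex_equivariant (E W : zmodType) (act : E -> W -> W) (X : set W) :
  (forall g h x, act g (act h x) = act (g + h) x) -> (forall x, act 0 x = x) ->
  (forall g x, X x -> X (act g x)) ->
  (forall g x, X x -> act g x = x -> g = 0) ->
  exists e : W -> E, forall g x, X x -> e (act g x) = e x + g.
Proof.
move=> actD act0 actX free.
pose orbit x := [set act g x | g in [set: E]].
have orbit_act g x : orbit (act g x) = orbit x.
  apply/seteqP; split => _ [h _ <-].
    by exists (h + g) => //; rewrite actD.
  by exists (h - g) => //; rewrite actD subrK.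
pose rep x := xget 0 (orbit x).
have repP x : exists h, act h (rep x) = x.
  have [h _ hx] : orbit x (rep x) by apply: (xgetPex 0); exists x, 0.
  by exists (- h); rewrite -hx actD addNr act0.
have rep_act g x : rep (act g x) = rep x by rewrite /rep orbit_act.
(* An element carrying the chosen representative of the orbit to [x]; freeness makes it unique on
   [X]. *)
pose e x := xget 0 [set h | act h (rep x) = x].
have eP x : act (e x) (rep x) = x by apply: (xgetPex 0 (repP x)).
exists e => g x Xx; apply/eqP; rewrite -subr_eq0; apply/eqP.
have Xr : X (rep x).
  have [h hx] := repP x; rewrite -(act0 (rep x)) -(addNr h) -actD hx.
  exact: actX.
apply: (free _ _ Xr); rewrite addrC -actD -(rep_act g) eP actD.
by rewrite opprD subrK -{2}(eP x) actD addNr act0 rep_act.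
Qed.

(** * Odd functions from a cover *)

Section OddFunctions.
Variables (R : realType) (E : lmodType 'F_2) (W : normedModType R).
Variables (act : E -> W -> W) (alpha : E -> 'F_2) (es : seq E).
Hypothesis actD : forall g h x, act g (act h x) = act (g + h) x.
Hypothesis act0 : forall x, act 0 x = x.
Hypothesis act_cont : forall g, continuous (act g).
Hypothesis alphaD : forall g h, alpha (g + h) = alpha g + alpha h.
Hypothesis es_uniq : uniq es.
Hypothesis es_full : forall g, g \in es.
Variables (Z : set W) (I : choiceType) (D : set I) (F : I -> set W) (m : nat).
Hypothesis Z_compact : compact Z.
Hypothesis Z_act : forall g x, Z x -> Z (act g x).
Hypothesis F_cover : forall z, Z z -> exists2 B, D B & F B z.
Hypothesis F_open : forall B z, D B -> Z z -> F B z ->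
  \forall w \near z, Z w -> F B w.
Hypothesis F_order : forall z, Z z -> ([set B | D B /\ F B z] #<= `I_m.+1)%card.
Hypothesis F_small : forall B g z, D B -> Z z -> F B z -> F B (act g z) ->
  alpha g = 0.

(** A finite unnormalised partition of unity on [Z]. Bumps on the balls of a finite subcover are
    summed according to the set [B] chosen for their centre, so that the order of the cover bounds
    the number of functions nonzero at a point. *)
Lemma ex_bumps : exists (Bs : seq I) (q : I -> W -> R),
  [/\ uniq Bs, forall B, B \in Bs -> D B,
      forall B, continuous (q B) /\ forall w, 0 <= q B w,
      forall B z, Z z -> q B z != 0 -> F B z &
      forall z, Z z -> exists2 B, B \in Bs & q B z != 0].
Proof.
have [[z0 Zz0]|Z0] := pselect (exists z, Z z); last first.
  exists [::], (fun _ _ => 0); split => //.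
  - by move=> B; split => // z; exact: cvg_cst.
  - by move=> B z Zz; case: Z0; exists z.
  - by move=> z Zz; case: Z0; exists z.
have /choice[Brho Hrho] : forall z, exists Brho : I * R, Z z ->
    [/\ D Brho.1, 0 < Brho.2 & forall w, Z w -> `|z - w| < Brho.2 -> F Brho.1 w].
  move=> z; have [Zz|nZz] := pselect (Z z); last first.
    by have [B _ _] := F_cover Zz0; exists (B, 0) => /nZz.
  have [B DB FBz] := F_cover Zz.
  have /nbhs_ballP[d /= d0 Hd] := F_open DB Zz FBz.
  exists (B, d) => _; split => //= w Zw zw; apply: Hd => //.
  by rewrite -ball_normE.
have cov : cover_compact Z by rewrite -compact_cover.
have [||fs fsZ Zfs] := cov W Z (fun z => ball z (Brho z).2).
- by move=> z _; exact: ball_open.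
- move=> z Zz; exists z => //; apply: ballxx.
  by have [] := Hrho z Zz.
have {}fsZ z : z \in fs -> Z z by move=> /fsZ /set_mem.
pose bump z w := Num.max 0 ((Brho z).2 - `|z - w|).
have bump_ge0 z w : 0 <= bump z w by rewrite le_max lexx.
pose q B w := \sum_(z <- fs | (Brho z).1 == B) bump z w.
exists (undup [seq (Brho z).1 | z <- fs]), q; split.
- exact: undup_uniq.
- move=> B; rewrite mem_undup => /mapP[z /fsZ Zz ->].
  by have [] := Hrho z Zz.
- move=> B; split; last by move=> w; exact: sumr_ge0.
  apply: continuous_big => [|z _ w]; first exact: add_continuous.
  apply: (@continuous_max R W (fun=> 0) (fun w => (Brho z).2 - `|z - w|)).
    exact: cvg_cst.
  apply: cvgB; first exact: cvg_cst.
  by apply: cvg_norm; apply: cvgB; [exact: cvg_cst|exact: cvg_id].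
- move=> B z Zz; apply: contraNP => nFB; rewrite /q big_seq_cond big1 // => x.
  move=> /andP[/fsZ Zx /eqP xB]; apply/max_idPl; rewrite subr_le0 leNgt.
  apply/negP => xz; apply: nFB; rewrite -xB.
  by have [_ _] := Hrho x Zx; exact.
move=> z Zz; have [x /= xfs xz] := Zfs z Zz.
exists (Brho x).1; first by rewrite mem_undup; exact: (map_f (fun z => (Brho z).1)).
rewrite gt_eqF // /q (big_rem x) //= eqxx ltr_pwDl ?sumr_ge0 //.
by rewrite lt_max subr_gt0; move: xz; rewrite -ball_normE /= => ->; rewrite orbT.
Qed.

Lemma card_has_le (T : finType) (Q : E -> T -> bool) (c : nat) (s : seq E) :
  (forall g, (#|[set t | Q g t]%SET| <= c)%N) ->
  (#|[set t | has (Q^~ t) s]%SET| <= size s * c)%N.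
Proof.
move=> Qc; elim: s => [|g s IH] /=.
  by rewrite (_ : [set t | false]%SET = finset.set0) ?cards0 //; apply/setP => t; rewrite !inE.
rewrite (_ : [set t | _]%SET = [set t | Q g t]%SET :|: [set t | has (Q^~ t) s]%SET).
  by apply: leq_trans (leq_card_setU _ _) _; rewrite mulSn leq_add.
by apply/setP => t; rewrite !inE.
Qed.

(** Antisymmetrise each bump: sum over g the sign of alpha(g) times q_B(g x). It is nonzero at z
    only if some g z lies in F B, and each of the |E| points g z lies in at most m + 1 of these
    sets. *)
Lemma ex_odd_functions : exists p (r : 'I_p -> W -> R),
  [/\ forall i, continuous (r i),
      forall i g x, r i (act g x) = sgF2 R (alpha g) * r i x,
      forall z, Z z -> exists i, r i z != 0 &
      forall z, Z z -> (#|[set i | r i z != 0%R]%SET| <= size es * m.+1)%N].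
Proof.
have [Bs [q [Bs_uniq BsD qP qF q_cover]]] := ex_bumps.
(* On Z all nonzero terms have the same sign, by F_small. *)
pose r (i : 'I_(size Bs)) w := \sum_(g <- es) sgF2 R (alpha g) * q (tnth (in_tuple Bs) i) (act g w).
exists (size Bs), r; split.
- move=> i; apply: continuous_big => [|g _ w]; first exact: add_continuous.
  apply: cvgM; first by apply: cvg_cst.
  apply: (@continuous_comp _ _ _ (act g)); first exact: act_cont.
  by have [qc _] := qP (tnth (in_tuple Bs) i); exact: qc.
- move=> i g x; rewrite /r mulr_sumr.
  have es_shift : perm_eq es [seq h + g | h <- es].
    apply: uniq_perm => //; first by rewrite map_inj_uniq //; exact: addIr.
    by move=> h; rewrite es_full; apply/esym/mapP; exists (h - g); rewrite ?subrK ?es_full.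
  rewrite [RHS](perm_big _ es_shift) big_map; apply: eq_bigr => h _.
  by rewrite actD alphaD sgF2D mulrA [sgF2 R (alpha g) * _]mulrCA sgF2_sqr mulr1.
- move=> z Zz; have [B BBs qB] := q_cover z Zz.
  have iB : (index B Bs < size Bs)%N by rewrite index_mem.
  exists (Ordinal iB); rewrite /r (tnth_nth B) /= nth_index //.
  rewrite (eq_bigr (fun g => q B (act g z))); last first.
    move=> g _; have [->|qg] := eqVneq (q B (act g z)) 0; first by rewrite mulr0.
    rewrite (F_small (BsD _ BBs) Zz (qF _ _ Zz qB) (qF _ _ (Z_act _ Zz) qg)).
    by rewrite sgF20 mul1r.
  rewrite (big_rem 0) ?es_full //= gt_eqF // ltr_pwDl //.
    by rewrite act0 lt_neqAle eq_sym qB; have [_ ->] := qP B.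
  by apply: sumr_ge0 => g _; have [_ ->] := qP B.
move=> z Zz; pose Q g i := `[< F (tnth (in_tuple Bs) i) (act g z) >].
apply: leq_trans (card_has_le (Q := Q) es _).
  apply: subset_leq_card; apply/fintype.subsetP => i; rewrite !inE.
  apply: contraNT => /hasPn noF; apply/eqP; rewrite /r big_seq big1 // => g /noF.
  rewrite /Q => /asboolPn nF; apply/eqP; rewrite mulf_eq0; apply/orP; right.
  by apply: contra_notT nF => qi; exact: (qF _ _ (Z_act _ Zz)).
move=> g; have /pcard_leP[f] := F_order (Z_act g Zz).
pose t (i : 'I_(size Bs)) : 'I_m.+1 := inord (f (tnth (in_tuple Bs) i)).
have FQ i : Q g i -> [set B | D B /\ F B (act g z)] (tnth (in_tuple Bs) i).
  by move=> /asboolP Fi; split => //; apply: BsD; exact: mem_tnth.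
have t_inj : {in [set i | Q g i]%SET &, injective t}.
  move=> i j; rewrite !finset.in_set => /FQ Fi /FQ Fj /(congr1 val).
  have fi : (f (tnth (in_tuple Bs) i) < m.+1)%N := @funS _ _ _ _ f _ Fi.
  have fj : (f (tnth (in_tuple Bs) j) < m.+1)%N := @funS _ _ _ _ f _ Fj.
  rewrite !val_insubd fi fj => fij.
  have /tuple_uniqP tnth_inj : uniq (in_tuple Bs) by [].
  by apply: tnth_inj; exact: inj (mem_set Fi) (mem_set Fj) fij.
rewrite -(card_in_imset t_inj); apply: leq_trans (max_card _) _.
by rewrite card_ord.
Qed.
End OddFunctions.

Lemma eval_at_continuous (T T' : topologicalType) (y : T) :
  continuous (fun phi : {compact-open, T -> T'} => phi y).
Proof.
move=> phi A /=; rewrite nbhsE => -[B [oB By] BA].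
have sub : phi @` [set y] `<=` B by move=> _ [_ -> <-].
have := (compact_open_cvgP phi (nbhs_filter phi)).1 cvg_id _ _ (@compact_set1 T y) oB sub.
by apply: filterS => psi psiB; apply/BA/psiB; exists y.
Qed.

(** The empty family covers an empty space. *)
Lemma covering_dim_le_empty (T : topologicalType) (n : nat) :
  ~ ([set: T] !=set0) -> covering_dim_le T n.
Proof.
move=> T0 C _; exists set0; split => [|A []|x].
- split => // ; apply/seteqP; split => // x _.
  by case: T0; exists x.
- by case: T0; exists x.
Qed.

(** * The zero set *)

Section ZeroSet.
Variables (R : realType) (E : lmodType 'F_2) (U V : euclideanModule R E).
Variables (r : nat) (v : 'I_r -> U) (a : 'I_r -> E -> 'F_2).
Hypothesis va : forall i, eigenvector (a i) (v i).
Hypothesis v0 : forall i, v i != 0.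
Hypothesis ov : forall i j, i != j -> inner (v i) (v j) = 0.
Hypothesis a_inj : forall g, (forall i, a i g = 0) -> g = 0.
Variables (es : seq E) (nV : nat) (w : 'I_nV -> V) (b : 'I_nV -> E -> 'F_2).
Hypothesis es_uniq : uniq es.
Hypothesis es_full : forall g, g \in es.
Hypothesis wb : forall j, eigenvector (b j) (w j).
Hypothesis w0 : forall j, w j != 0.
Hypothesis b0 : forall j, exists g, b j g != 0.
Hypothesis w_full : forall u, (forall j, inner u (w j) = 0) -> u = 0.
Variable f : pointed_map U -> V.
Hypothesis f_cont : continuous f.
Hypothesis f_act : forall (g : E) (phi : pointed_map U),
  f (pointed_map_act g phi) = act g (f phi).
Variable i0 : 'I_r.
Hypothesis a0 : exists g, a i0 g != 0.
Variable d : nat.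

(** Bounds the number of colours needed if the dimension is at most d. The other nV of the n sign
    functions come from the components of [f]. *)
Let L := (size es * d.+1)%N.
Let n := (nV + L)%N.
Local Notation W := 'M[R]_(n.+1, r).
Implicit Types (M : W) (g h : E).
Let Psi : W -> pointed_map U := poly_map v (n := n).
Let actW : E -> W -> W := fun g => sgmx R a n g.

Definition zero_mx : set W := [set M | free_mx M /\ f (Psi M) = 0].
Definition zero_set : set (pointed_map U) := Psi @` zero_mx.

Let aD i g h : a i (g + h) = a i g + a i h.
Proof. by rewrite (eigenvectorD (va i) (v0 i)). Qed.

Let bD j g h : b j (g + h) = b j g + b j h.
Proof. by rewrite (eigenvectorD (wb j) (w0 j)). Qed.

Let a00 i : a i 0 = 0.
Proof. by have := aD i 0 0; rewrite addr0 addF2. Qed.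

Let actWD g h M : actW g (actW h M) = actW (g + h) M.
Proof. by apply/matrixP => l i; rewrite !sgmxE aD sgF2D mulrA. Qed.

Let actW0 M : actW 0 M = M.
Proof. by apply/matrixP => l i; rewrite sgmxE a00 sgF20 mul1r. Qed.

Let actW_continuous g : continuous (actW g).
Proof.
move=> M; apply: (@cvgrPdist_lt _ _ _ _ (nbhs_filter M) _ _).2 => e e0.
apply: filterS (near_dist_lt M e0) => M'.
by rewrite -linearB norm_sgmx.
Qed.

Let Psi_act g M : pointed_map_act g (Psi M) = Psi (actW g M).
Proof. exact: poly_map_act. Qed.

Let fPsi_continuous : continuous (f \o Psi).
Proof.
move=> M; apply: continuous_comp; last exact: f_cont.
exact: poly_map_continuous.
Qed.

Lemma zero_mx_compact : compact zero_mx.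
Proof.
rewrite (_ : zero_mx = @free_mx R r n `&` [set M | `|f (Psi M)| <= 0]).
  apply: compact_closedI; first exact: free_mx_compact.
  apply: (closed_comp (f := fun M => `|f (Psi M)|) (D := [set x | x <= 0])).
    move=> M _; apply: (@continuous_comp _ _ _ (f \o Psi) Num.norm).
      exact: fPsi_continuous.
    exact: norm_continuous.
  exact: closed_le.
by apply/seteqP; split => M [XM] /=; rewrite normr_le0 => /eqP.
Qed.

Lemma zero_mx_act g M : zero_mx M -> zero_mx (actW g M).
Proof.
case=> XM fM; split; first exact: free_mx_act.
by rewrite -Psi_act f_act fM /act linear0.
Qed.

Lemma zero_set_compact : compact zero_set.
Proof.
apply: continuous_compact; last exact: zero_mx_compact.
by apply: continuous_subspaceT; exact: poly_map_continuous.
Qed.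

Lemma zero_set_invariant : invariant_set (@pointed_map_act R E U) zero_set.
Proof.
move=> g _ [M ZM <-]; exists (actW g M); first exact: zero_mx_act.
by rewrite Psi_act.
Qed.

Lemma Psi_inj : injective Psi.
Proof.
move=> M M' MM'; apply/matrixP => l i.
apply: (mulIf (node_coef_neq0 v0 l i)).
by rewrite -!(poly_map_node v0 ov) -/(Psi _) MM'.
Qed.

Lemma zero_set_free : acts_freely_on (@pointed_map_act R E U) zero_set.
Proof.
move=> g _ [M [XM _] <-]; rewrite Psi_act => /Psi_inj gM.
exact/a_inj/(free_mx_free XM gM).
Qed.

(** The cover to refine consists of the sets where a coordinate x_l in the column [i0] has a given
    sign. They cover because some row has no zero entry. No member contains both a point and its
    translate by g with a_i0(g) = 1, which changes the sign of x_l; refinements inherit this. *)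
Lemma ex_odd_functions_zero (m : nat) : covering_dim_le (set_type zero_set) m ->
  exists p (rr : 'I_p -> W -> R),
  [/\ forall i, continuous (rr i),
      forall i g x, rr i (actW g x) = sgF2 R (a i0 g) * rr i x,
      forall z, zero_mx z -> exists i, rr i z != 0 &
      forall z, zero_mx z ->
        (#|[set i | rr i z != 0%R]%SET| <= size es * m.+1)%N].
Proof.
move=> dim_m; pose T := set_type zero_set.
pose x (l : 'I_n.+1) (phi : T) : R := \val (\val phi) (node v0 l i0).
have x_cont l : continuous (x l).
  move=> phi; apply: (@continuous_comp _ _ _ (fun phi : T => \val (\val phi))
    (fun psi : {compact-open, sphere U -> R} => psi (node v0 l i0))).
    apply: (@continuous_comp _ _ _ (set_val : T -> pointed_map U)
      (set_val : pointed_map U -> {compact-open, sphere U -> R})).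
      exact: initial_continuous.
    exact: initial_continuous.
  exact: eval_at_continuous.
pose C := [set A : set T | exists l (e : bool), A = [set phi | 0 < (-1) ^+ e * x l phi]].
have C_open A : C A -> open A.
  move=> [l [e ->]].
  apply: (@open_comp _ _ (fun phi => (-1) ^+ e * x l phi) [set t | 0 < t]).
    by move=> phi _; exact: (cvgM (cvg_cst _) (x_cont l phi)).
  exact: open_gt.
have C_cover : \bigcup_(A in C) A = setT.
  apply/seteqP; split => // phi _.
  have /set_mem[M [[_ [l Ml]] _] Mphi] := valP phi.
  have xM : x l phi != 0.
    rewrite /x -Mphi (poly_map_node v0 ov) mulf_neq0 ?(node_coef_neq0 v0) //.
    rewrite -normr_gt0.
    by apply: lt_le_trans (Ml i0); rewrite invr_gt0 ltr0n.
  exists [set psi | 0 < (-1) ^+ (x l phi < 0)%R * x l psi].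
    by exists l, (x l phi < 0)%R.
  by rewrite /= -normrEsign normr_gt0.
have [D [[Dopen Dcover] Dref Dorder]] := dim_m C (conj C_open C_cover).
pose F (B : set T) := [set M | exists2 phi : T, \val phi = Psi M & B phi].
have toT M : zero_mx M -> exists phi : T, \val phi = Psi M.
  move=> ZM; have ZPsi : Psi M \in zero_set by apply/mem_set; exists M.
  by exists (exist _ (Psi M) ZPsi).
apply: (@ex_odd_functions R E W actW (a i0) es actWD actW0 actW_continuous
  (aD i0) es_uniq es_full zero_mx (set T) D F m zero_mx_compact zero_mx_act).
- move=> M /toT[phi phiM].
  have : (\bigcup_(A in D) A) phi by rewrite Dcover.
  by case=> B DB Bphi; exists B => //; exists phi.
- move=> B M DB ZM [phi phiM Bphi].
  have [Q oQ QB] := Dopen B DB.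
  have : \forall M' \near M, Q (Psi M').
    have Psi_cont : continuous Psi by exact: poly_map_continuous.
    apply: (Psi_cont M Q); apply: open_nbhs_nbhs; split => //.
    by rewrite -/(Psi M) -phiM; move: Bphi; rewrite -QB.
  apply: filterS => M' QM' /toT[psi psiM]; exists psi => //.
  by move: QM'; rewrite -psiM -QB.
- move=> M /toT[phi phiM]; apply: card_le_trans (Dorder phi).
  apply: subset_card_le => B [DB [psi psiM Bpsi]]; split => //.
  by have -> : phi = psi by apply: val_inj; rewrite phiM psiM.
move=> B g M DB ZM [phi phiM Bphi] [psi psiM Bpsi].
have [A [l [e ->]] BA] := Dref B DB.
have := BA _ Bpsi; have := BA _ Bphi; rewrite /= /x psiM phiM !(poly_map_node v0 ov).
rewrite sgmxE; have [->//|/F2_eq1->] := eqVneq (a i0 g) 0.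
rewrite /sgF2 expr1 mulN1r mulNr mulrN oppr_gt0 => p1 p2.
by have := lt_trans p1 p2; rewrite ltxx.
Qed.

(** If m <= d, then n sign functions, one of them locally constant at each point, contradict
    [free_mx_not_locally_constant]: the sign of a nonzero component of [f] off the zero set, and a
    colour on it. *)
Lemma zero_set_dim m : covering_dim_le (set_type zero_set) m -> (d < m)%N.
Proof.
move=> /ex_odd_functions_zero[p [rr [rr_cont rr_act rr_cover rr_order]]].
rewrite ltnNge; apply/negP => md.
have [sec secE] : exists e : W -> E, forall g M, free_mx M -> e (actW g M) = e M + g.
  apply: ex_equivariant => //.
  - by move=> g M; exact: free_mx_act.
  - by move=> g M XM gM; exact/a_inj/(free_mx_free XM gM).
pose x j M := inner (f (Psi M)) (w j).
have x_cont j : continuous (x j).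
  move=> M; apply: (@continuous_comp _ _ _ (f \o Psi) (fun u : V => inner u (w j))).
    exact: fPsi_continuous.
  exact: inner_continuous.
have xE j g M : x j (actW g M) = sgF2 R (b j g) * x j M.
  by rewrite /x -Psi_act f_act inner_actl wb innerZr.
(* Where a component vanishes, the discontinuous map [sec] supplies values that still shift by
   [b j g]. *)
pose s k M := if insub k is Some j then
    if x j M == 0 then b j (sec M) else sign_of (x j M)
  else colour (fun M => a i0 (sec M)) rr (k - nV) M.
pose c k g := if insub k is Some j then b j g else a i0 g.
apply: (@free_mx_not_locally_constant R E r a n s c).
- move=> k g M XM; rewrite /s /c; case: insub => [j|].
    rewrite xE mulf_eq0 -normr_eq0 sgF2_norm oner_eq0 /=.
    by case: eqVneq => [_|xj]; [rewrite secE // bD|rewrite sign_ofM].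
  apply: (colour_act (act := actW) (X := @free_mx R r n)) XM => // h M' XM'.
  by rewrite secE // aD.
- by move=> k; rewrite /c; case: insub.
move=> M XM.
have [fM|fM] := eqVneq (f (Psi M)) 0.
  have ZM : zero_mx M by [].
  have [k kL Hk] := colour_near (fun M => a i0 (sec M)) rr_cont
    (rr_cover M ZM) (rr_order M ZM).
  exists (nV + k)%N.
    by rewrite ltn_add2l; apply: leq_trans kL _; rewrite leq_mul2l ltnS md orbT.
  apply: filterS Hk => M' HM' _; rewrite /s insubF ?addKn //.
  by rewrite ltnNge leq_addr.
have [j xj] : exists j, x j M != 0.
  apply: contrapT => /forallNP x0; move/eqP: fM; apply; apply: w_full => j.
  by apply/eqP; have /negP := x0 j; rewrite negbK.
exists j; first by rewrite ltn_addr.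
apply: filterS (sign_of_near (x_cont j) xj) => M' [xj' sj] _.
by rewrite /s valK (negPf xj) (negPf xj').
Qed.
End ZeroSet.

Theorem proposition2p13 (R : realType) (E : lmodType 'F_2)
  (hE : exists g : E, g <> 0)
  (U V : euclideanModule R E)
  (hU : exists u : U, u <> 0)
  (hker : \bigcap_(alpha in [set alpha : {scalar E} | eigenset U alpha <> [set 0]])
            [set g : E | alpha g = 0] = [set 0])
  (hV : fixed_points V = [set 0])
  (f : pointed_map U -> V)
  (hfcont : continuous f)
  (hfequiv : forall (g : E) (phi : pointed_map U),
      f (pointed_map_act g phi) = act g (f phi))
  (d : nat) :
  exists K : set (pointed_map U),
    [/\ K `<=` [set phi | f phi = 0],
        compact K,
        invariant_set (@pointed_map_act R E U) K,
        acts_freely_on (@pointed_map_act R E U) K &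
        covering_dim_ge (set_type K) d].
Proof.
have [r [v [a [va ov a_inj]]]] := ex_faithful_eigenvectors hker.
have vaE i := (va i).1; have v0 i := (va i).2.
have aD i := eigenvectorD (vaE i) (v0 i).
have [es es_uniq es_full] := ex_enum aD a_inj.
have [nV [w [b [wb b0 w_full]]]] := ex_complete_eigenvectors es_full hV.
have wbE j := (wb j).1; have w0 j := (wb j).2.
have [i0 a0] : exists i0, exists g, a i0 g != 0.
  have [g g0] := hE; apply: contrapT => /forallNP H; apply: g0; apply: a_inj => i.
  by apply/eqP; apply: contrapT => /negP ai; apply: (H i); exists g.
exists (zero_set v es nV f d); split.
- by move=> _ [M [_ fM] <-].
- exact: zero_set_compact.
- exact: zero_set_invariant.
- exact: zero_set_free.
have dimK m := zero_set_dim vaE v0 ov a_inj es_uniq es_full wbE w0 b0 w_full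
  hfcont hfequiv a0 (m := m) (d := d).
split; last by move=> m /dimK/ltnW.
(* An empty zero set would have dimension at most 0, giving d < 0. *)
by apply: contrapT => /(@covering_dim_le_empty _ 0)/dimK.
Qed.
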